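(* Let $\kappa$ be a regular cardinal such that $|\alpha|^{\aleph_0}<\kappa$ for all ordinals $\alpha<\kappa$. Then there exists an $\aleph_1$-free abelian group $G$ of cardinality $\kappa$ such that, for any subgroup $U$ of $G$ with $|U|=\kappa$, either $G=U$ or $G/U$ is not cotorsion-free.
   Context: An abelian group is $\aleph_1$-free if all its countable subgroups are free (equivalently, every finite rank subgroup is free). An abelian group is cotorsion-free if it is torsion-free and contains no subgroup isomorphic to the rationals $\mathbb{Q}$ or to the additive group $J_p$ of $p$-adic integers for any prime $p$. *)

(* Defs.v *)
(* MathComp, with the cardinality theory of mathcomp.classical. *)
From HB Require Import structures.
From mathcomp Require Import all_boot all_order all_algebra.
From mathcomp Require Import boolp classical_sets functions cardinality wochoice.

Set Implicit Arguments.
Unset Strict Implicit.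
Unset Printing Implicit Defensive.

Import Order.TTheory GRing.Theory.

Local Open Scope classical_set_scope.
Local Open Scope card_scope.
Local Open Scope ring_scope.

Definition card_lt (T U : Type) (A : set T) (B : set U) : Prop :=
  (A #<= B) /\ (A #!= B).

(* A cardinal is an initial ordinal, given as a well-ordered type K; the
   ordinals smaller than it are the proper initial segments
   [set x | x < a] for a : K. *)
Definition initial_ordinal (d : Order.disp_t) (K : orderType d) : Prop :=
  well_order (<=%O : rel K) /\
  (forall a : K, card_lt [set x : K | (x < a)%O] [set: K]).

Definition cofinal (d : Order.disp_t) (K : orderType d) (A : set K) : Prop :=
  forall x : K, exists2 y : K, A y & (x <= y)%O.

Definition regular_cardinal (d : Order.disp_t) (K : orderType d) : Prop :=
  [/\ initial_ordinal K,
      infinite_set [set: K] &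
      forall A : set K, cofinal A -> A #= [set: K]].

Definition Z_independent (G : zmodType) (B : set G) : Prop :=
  forall (s : seq G) (c : G -> int),
    uniq s -> (forall b, b \in s -> B b) ->
    \sum_(b <- s) b *~ c b = 0 -> forall b, b \in s -> c b = 0.

Definition Z_span (G : zmodType) (B : set G) : set G :=
  [set x | exists (s : seq G) (c : G -> int),
    (forall b, b \in s -> B b) /\ x = \sum_(b <- s) b *~ c b].

Definition free_subgroup (G : zmodType) (U : zmodClosed G) : Prop :=
  exists B : set G, Z_independent B /\ Z_span B = [set` U].

Definition aleph1_free (G : zmodType) : Prop :=
  forall U : zmodClosed G, countable [set` U] -> free_subgroup U.

(* The p-adic integers, as the inverse limit over n of Z/p^(n+1); the index is
   shifted because 'Z_1 is not the trivial ring.  Only prime p is meaningful. *)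
Record padic_int (p : nat) := PadicInt {
  padic_val : forall n, 'Z_(p ^ n.+1);
  padic_valP : forall n, (padic_val n.+1 : nat)%:R = padic_val n }.

Section PadicInt.
Variable p : nat.
Implicit Types x y z : padic_int p.

Let red n (a : 'Z_(p ^ n.+2)) : 'Z_(p ^ n.+1) := (a : nat)%:R.

Lemma padic_inj x y : (forall n, padic_val x n = padic_val y n) -> x = y.
Proof.
case: x y => [u uP] [v vP] /= uv.
have {uv} E : u = v by apply: functional_extensionality_dep.
by case: v / E vP => vP; congr PadicInt; apply: Prop_irrelevance.
Qed.

Lemma Zp_trunc_dvd n : ((Zp_trunc (p ^ n.+1)).+2 %| (Zp_trunc (p ^ n.+2)).+2)%N.
Proof.
have [p1|p1] := leqP p 1.
  by case: p p1 => [|[|//]] _; rewrite ?exp0n ?exp1n.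
have p_gt0 := ltnW p1.
have h m : (1 < p ^ m.+1)%N.
  by rewrite expnS (leq_trans p1)// leq_pmulr// expn_gt0 p_gt0.
by rewrite !Zp_cast ?h // [in X in (_ %| X)%N]expnS dvdn_mull.
Qed.

Lemma red_nat n k : red (k%:R) = k%:R :> 'Z_(p ^ n.+1).
Proof.
by apply: val_inj; rewrite /red !Zp_nat /= modn_dvdm ?Zp_trunc_dvd.
Qed.

Lemma redD n (a b : 'Z_(p ^ n.+2)) : red (a + b) = red a + red b.
Proof. by rewrite -[in LHS](natr_Zp a) -[in LHS](natr_Zp b) -natrD red_nat natrD. Qed.

Lemma red0 n : red (0 : 'Z_(p ^ n.+2)) = 0.
Proof. by []. Qed.

Lemma redN n (a : 'Z_(p ^ n.+2)) : red (- a) = - red a.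
Proof. by apply/eqP; rewrite -addr_eq0 -redD addNr red0. Qed.

Definition padic_zero : padic_int p :=
  @PadicInt p (fun=> 0) (fun n => red0 n).

Lemma padic_add_subproof x y n :
  red (padic_val x n.+1 + padic_val y n.+1) = padic_val x n + padic_val y n.
Proof. by rewrite redD /red !padic_valP. Qed.

Definition padic_add x y : padic_int p := PadicInt (padic_add_subproof x y).

Lemma padic_opp_subproof x n : red (- padic_val x n.+1) = - padic_val x n.
Proof. by rewrite redN /red padic_valP. Qed.

Definition padic_opp x : padic_int p := PadicInt (padic_opp_subproof x).

Lemma padic_addA : associative padic_add.
Proof. by move=> x y z; apply: padic_inj => n; apply: addrA. Qed.

Lemma padic_addC : commutative padic_add.
Proof. by move=> x y; apply: padic_inj => n; apply: addrC. Qed.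

Lemma padic_add0 : left_id padic_zero padic_add.
Proof. by move=> x; apply: padic_inj => n; apply: add0r. Qed.

Lemma padic_addN : left_inverse padic_zero padic_opp padic_add.
Proof. by move=> x; apply: padic_inj => n; apply: addNr. Qed.

HB.instance Definition _ := gen_eqMixin (padic_int p).
HB.instance Definition _ := gen_choiceMixin (padic_int p).
HB.instance Definition _ := GRing.isZmodule.Build (padic_int p)
  padic_addA padic_addC padic_add0 padic_addN.

End PadicInt.

Definition torsion_free (H : zmodType) : Prop :=
  forall (x : H) (n : nat), (0 < n)%N -> x *+ n = 0 -> x = 0.

Definition has_subgroup_isomorphic_to (A H : zmodType) : Prop :=
  exists (V : zmodClosed H) (f : {additive A -> H}),
    set_bij [set: A] [set` V] f.

Definition cotorsion_free (H : zmodType) : Prop :=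
  [/\ torsion_free H,
      ~ has_subgroup_isomorphic_to rat H &
      forall p : nat, prime p -> ~ has_subgroup_isomorphic_to (padic_int p) H].

(* Main.v *)
(** The group G is a pure subgroup of the functions K -> M with countable
    support, where M is torsion-free and contains the sums of all series
    sum_l l! c_l.  It contains the units e_g and, inductively, certain limits
    y = sum_l l! (u_l + c_l e_g) of elements u_l of G.  The u_l are arranged in
    omega many blocks: the n-th block has disjoint supports converging to an
    ordinal b_n, and the b_n converge to a.  A partition of the ordinals of
    cofinality omega into K stationary sets lets b_n code everything chosen
    before the n-th block, together with g and c.  Hence two different limits
    with the same a have no common b_n from some n on; as the supports of
    elements used by the limits of a given class do not accumulate at b_n, a
    limit can be isolated from finitely many others on one of the intervals
    that carry its u_l.  This gives enough Z-valued functionals on every finite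
    rank pure subgroup, and Pontryagin's criterion yields aleph_1-freeness.

    If U has size K, then by counting U contains nonzero elements supported
    arbitrarily far out, hence for all g and c a family (u_l) as above.  Modulo
    U the limit y is the multiple of e_g by the profinite integer
    sum_l l! c_l.  If G/U is cotorsion-free and e_g is not in U, these multiples
    form a copy of J_p in G/U for some p, a contradiction; so all e_g are in U,
    and U, being closed under pure roots and limits, is G. *)
Require Import Defs.
From HB Require Import structures.
From mathcomp Require Import all_boot all_order all_algebra.
From mathcomp Require Import boolp classical_sets functions cardinality.
From mathcomp Require Import zify.

Set Implicit Arguments.
Unset Strict Implicit.
Unset Printing Implicit Defensive.

Import Order.TTheory GRing.Theory Num.Theory.

Local Open Scope classical_set_scope.
Local Open Scope card_scope.
Local Open Scope ring_scope.

(** * Comparing cardinals through functions *)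

Lemma card_le_inj (T U : Type) (A : set T) (B : set U) (f : T -> U) :
  (forall x, A x -> B (f x)) ->
  (forall x y, A x -> A y -> f x = f y -> x = y) -> A #<= B.
Proof.
move=> fAB finj.
have fI : {in A &, injective f}.
  by move=> x y /set_mem Ax /set_mem Ay; apply: finj.
have /card_eqPle[_ h] := inj_card_eq fI.
apply: card_le_trans h _; apply: subset_card_le.
by move=> _ [x Ax <-]; apply: fAB.
Qed.

Lemma card_le_injE (T U : Type) (A : set T) (B : set U) (u0 : U) :
  A #<= B -> exists f : T -> U, (forall x, A x -> B (f x)) /\
    (forall x y, A x -> A y -> f x = f y -> x = y).
Proof.
move=> AB.
pose PU : pointedType := HB.pack U (gen_eqMixin U) (gen_choiceMixin U) (isPointed.Build U u0).
have /(@pcard_leP T PU)[f] := AB.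
exists f; split; first by move=> x; apply: funS.
by move=> x y Ax Ay; apply: (@inj _ _ _ f); apply: mem_set.
Qed.

Lemma card_eq_bijE (T U : Type) (A : set T) (B : set U) (u0 : U) :
  A #= B -> exists f : T -> U, set_bij A B f.
Proof.
move=> AB.
pose PU : pointedType := HB.pack U (gen_eqMixin U) (gen_choiceMixin U) (isPointed.Build U u0).
by have /(@card_set_bijP T PU)[f] := AB; exists f.
Qed.

(** * Stationary sets in a regular cardinal *)

Section Ordinals.
Variables (d : Order.disp_t) (K : orderType d).
Hypothesis regK : regular_cardinal K.
Hypothesis powK : forall a : K,
  card_lt [set f : nat -> K | forall n, (f n < a)%O] [set: K].

Local Notation below a := [set x : K | (x < a)%O].
Local Notation seqs a := [set f : nat -> K | forall n, (f n < a)%O].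

Lemma least (A : set K) : A !=set0 ->
  exists2 x, A x & forall y, A y -> (x <= y)%O.
Proof.
case=> a Aa; case: regK => -[wo _] _ _.
have [|z [[zA zl] _]] := wo (fun x => `[< A x >]).
  by exists a; apply/asboolP.
by exists z; [apply/asboolP|move=> y Ay; apply: zl; apply/asboolP].
Qed.

Lemma lt_wf : well_founded (fun x y : K => (x < y)%O).
Proof.
move=> x; apply: contrapT => nx.
have [|y ny yl] := @least [set x | ~ Acc (fun x y : K => (x < y)%O) x].
  by exists x.
apply: ny; constructor => z zy; apply: contrapT => nz.
by have := yl z nz; rewrite leNgt zy.
Qed.

Lemma K_inhabited : exists x : K, True.
Proof. by case: regK => _ /infinite_setN0[x _] _; exists x. Qed.

Definition k0 : K := projT1 (cid K_inhabited).

(* Stronger than having size less than K; chosen because it passes to images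
   and to countable codings without further cardinal arithmetic. *)
Definition small (T : Type) (A : set T) := exists a : K, A #<= seqs a.

Lemma small_lt T (A : set T) : small A -> ~ ([set: K] #<= A).
Proof.
move=> [a Aa] KA; have [h1 /negP] := powK a; apply.
by apply/card_eqPle; split => //; apply: card_le_trans KA _.
Qed.

Lemma small_sub T (A : set T) U (B : set U) : A #<= B -> small B -> small A.
Proof. by move=> AB [a Ba]; exists a; apply: card_le_trans Ba. Qed.

Lemma small_image T U (f : T -> U) (A : set T) : small A -> small (f @` A).
Proof. by apply: small_sub; exact: card_image_le. Qed.

(** An unbounded set is cofinal, hence by regularity of the size of [K], which no small set has. *)
Lemma small_bounded (A : set K) : small A -> exists b, forall x, A x -> (x < b)%O.
Proof.
move=> sA; apply: contrapT => nb; apply: (small_lt sA).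
case: regK => _ _ h; apply: (proj2 (proj1 (card_eqPle _ _) (h A _))).
move=> x; apply: contrapT => nx; apply: nb; exists x => y Ay.
by rewrite ltNge; apply/negP => xy; apply: nx; exists y.
Qed.

Lemma small_below a : small (below a).
Proof.
exists a; apply: (@card_le_inj _ _ _ _ (fun x _ => x)) => //=.
by move=> x y _ _ /(congr1 (@^~ 0%N)).
Qed.

Lemma no_max (a : K) : exists b, (a < b)%O.
Proof.
apply: contrapT => na; case: regK => _ infK h; apply: infK.
apply: (@card_le_finite _ _ _ [set a]); last exact: finite_set1.
apply: (proj2 (proj1 (card_eqPle _ _) (h [set a] _))).
move=> x; exists a => //; rewrite leNgt; apply/negP => ax.
by apply: na; exists x.
Qed.

Lemma small_countable T (A : set T) : countable A -> small A.
Proof.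
move=> cA; have [x1 x01] := no_max k0; have [a x1a] := no_max x1.
exists a; apply: card_le_trans cA _.
apply: (@card_le_inj _ _ _ _ (fun n k => if k == n then x1 else k0)) => //=.
  by move=> n _ k; case: ifP => _ //; apply: lt_trans x1a.
move=> m n _ _ /(congr1 (@^~ m)); rewrite eqxx; case: eqP => // _ e.
by move: x01; rewrite e ltxx.
Qed.

Lemma fun_bounded T (A : set T) (f : T -> K) : small A ->
  exists b, forall x, A x -> (f x < b)%O.
Proof.
move=> /(small_image f)/small_bounded[b hb].
by exists b => x Ax; apply: hb; exists x.
Qed.

Lemma nat_bounded (f : nat -> K) : exists b, forall n, (f n < b)%O.
Proof.
have [b hb] := fun_bounded f (small_countable (countableP [set: nat])).
by exists b => n; apply: hb.
Qed.

Lemma below_bounded (f : K -> K) a : exists b, forall x, (x <= a)%O -> (f x < b)%O.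
Proof.
have [a' aa'] := no_max a.
have [b hb] := fun_bounded f (small_below a').
by exists b => x xa; apply: hb; exact: le_lt_trans aa'.
Qed.

(** A witness that [b] has cofinality omega. *)
Definition ladder (l : nat -> K) (b : K) :=
  [/\ forall n, (l n < l n.+1)%O, forall n, (l n < b)%O &
      forall x, (x < b)%O -> exists n, (x < l n)%O].

Definition omega_limit b := exists l, ladder l b.

Definition closed_under (F : K -> K) b := forall x, (x < b)%O -> (F x < b)%O.

(** Stationarity among the ordinals of cofinality omega, with closed unbounded sets replaced by the
    sets of closure points of a function. *)
Definition stationary (X : set K) := forall F : K -> K,
  exists b, [/\ X b, omega_limit b & closed_under F b].

Lemma ladder_mono l b m n : ladder l b -> (m <= n)%N -> (l m <= l n)%O.
Proof.
move=> [h _ _]; elim: n => [|n IH]; first by rewrite leqn0 => /eqP ->.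
rewrite leq_eqVlt => /orP[/eqP ->//|]; rewrite ltnS => /IH mn.
exact: le_trans mn (ltW (h n)).
Qed.

Lemma stationary_above X F a : stationary X ->
  exists b, [/\ X b, omega_limit b, closed_under F b & (a < b)%O].
Proof.
move=> /(_ (fun x => Order.max (F x) a))[b [Xb ob cb]].
exists b; split => //.
  by move=> x /cb; rewrite gt_max => /andP[].
have [l [_ lb _]] := ob.
by have := cb _ (lb 0%N); rewrite gt_max => /andP[].
Qed.

(** Iterating a strict bound for [F] omega times from any point gives a ladder whose supremum is
    closed under [F]. *)
Lemma stationaryT : stationary setT.
Proof.
move=> F.
have /choice[F' F'P] x : exists y, (x < y)%O /\ forall z, (z <= x)%O -> (F z < y)%O.
  have [y hy] := below_bounded F x; have [y' xy'] := no_max x.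
  exists (Order.max y y'); split; first by rewrite lt_max xy' orbT.
  by move=> z /hy zy; rewrite lt_max zy.
pose l n := iter n F' k0.
have lS n : (l n < l n.+1)%O by have [] := F'P (l n).
have [b0 hb0] := nat_bounded l.
have [b lb bmin] : exists2 b, (forall n, (l n < b)%O) &
    forall y, (forall n, (l n < y)%O) -> (b <= y)%O.
  by apply: (@least [set b | forall n, (l n < b)%O]); exists b0.
have lad : ladder l b.
  split => // x xb; apply: contrapT => nx.
  suff /bmin : forall n, (l n < x)%O by rewrite leNgt xb.
  move=> n; apply: (lt_le_trans (lS n)); rewrite leNgt; apply/negP => xl.
  by apply: nx; exists n.+1.
exists b; split => //; first by exists l.
move=> x /(let: And3 _ _ h := lad in h)[n xl].
apply: lt_trans (lb n.+1); have [_] := F'P (l n); apply; exact: ltW.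
Qed.

(* Solovay: fix a ladder below every omega-limit.  At some height the rungs are
   unbounded on stationary sets, and Fodor's lemma then makes cofinally many
   fibres of the rung at this height stationary. *)
Lemma stationary_partition : exists s : K -> K,
  forall c, stationary [set b | s b = c].
Proof.
have /choice[lad ladP] b : exists l, omega_limit b -> ladder l b.
  have [[l ?]|nb] := pselect (omega_limit b); first by exists l.
  by exists (fun=> b).
(* Otherwise each height [n] fails at some bound [e n], refuted by some [F n]. But a point above all
   [e n] and closed under all [F n] has a ladder, one of whose rungs passes all the [e n]. *)
have [n0 hn0] : exists n, forall e, stationary [set b | (e <= lad b n)%O].
  apply: contrapT => no.
  have /choice[e eP] n : exists e, ~ stationary [set b | (e <= lad b n)%O].
    by apply: contrapT => ne; apply: no; exists n => e; apply: contrapT => h;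
       apply: ne; exists e.
  have /choice[F FP] n : exists F : K -> K, forall b, (e n <= lad b n)%O ->
      omega_limit b -> ~ closed_under F b.
    apply: contrapT => nF; apply: (eP n) => F; apply: contrapT => nb.
    by apply: nF; exists F => b eb ob cb; apply: nb; exists b.
  have [e0 he0] := nat_bounded e.
  have /choice[F0 F0P] x : exists y, forall n, (F n x < y)%O.
    exact: nat_bounded (fun n => F n x).
  have [b [_ ob cb eb]] := stationary_above F0 e0 stationaryT.
  have [_ _ /(_ _ eb)[n en]] := ladP _ ob.
  apply: (FP n b) => //; first exact: ltW (lt_trans (he0 n) en).
  by move=> x /cb; apply: lt_trans.
pose h b := lad b n0.
have hlt b (ob : omega_limit b) : (h b < b)%O by have [_ h1 _] := ladP _ ob; exact: h1.
pose T := [set c | stationary [set b | h b = c]].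
have Tcof : cofinal T.
  move=> e; apply: contrapT => no.
  have /choice[F FP] c : exists F : K -> K, (e <= c)%O -> forall b, h b = c ->
      omega_limit b -> ~ closed_under F b.
    apply: contrapT => nF.
    have ec : (e <= c)%O.
      by rewrite leNgt; apply/negP => ce; apply: nF; exists id; rewrite leNgt ce.
    apply: no; exists c => // F; apply: contrapT => nb.
    by apply: nF; exists F => _ b hb ob cb; apply: nb; exists b.
  have /choice[F1 F1P] (cx : K * K) : exists y, forall z, (z <= cx.2)%O ->
      (F cx.1 z < y)%O by exact: below_bounded.
  (* Fodor's diagonal bound: [F2 x] exceeds [F c z] for all [c] and [z] up to [x]. As [h b < b],
     closure of [b] under [F2] gives closure under [F (h b)]. *)
  have /choice[F2 F2P] x : exists y, forall c, (c <= x)%O -> (F1 (c, x) < y)%O.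
    exact: below_bounded (fun c => F1 (c, x)) x.
  have [b [eb ob cb]] := hn0 e F2.
  apply: (FP (h b) eb b) => // x xb.
  have mb : (Order.max x (h b) < b)%O by rewrite gt_max xb hlt.
  apply: lt_trans (cb _ mb); apply: lt_trans (F2P _ (h b) _); last first.
    by rewrite le_max lexx orbT.
  by apply: (F1P (_, _)); rewrite /= le_max lexx.
(* By regularity there are [K] many stationary fibres; a bijection from [T] to [K] relabels them. *)
case: regK => _ _ /(_ _ Tcof)/(card_eq_bijE k0)[t [tfun tinj tsurj]].
exists (t \o h) => c F; have [a Ta ac] := tsurj c I.
by have [b [hb ob cb]] := Ta F; exists b; split => //=; rewrite hb.
Qed.

End Ordinals.

(** * Injections into a regular cardinal closed under countable powers *)

Section Power.
Variables (d : Order.disp_t) (K : orderType d).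
Hypothesis regK : regular_cardinal K.
Hypothesis powK : forall a : K,
  card_lt [set f : nat -> K | forall n, (f n < a)%O] [set: K].
Let small := @small d K.

(** By well-founded recursion, [B a] is chosen above all values [c a' (B a')] already determined. *)
Lemma wf_choice_bound (c : K -> K -> K) :
  exists B : K -> K, forall a' a, (a' < a)%O -> (c a' (B a') < B a)%O.
Proof.
have /choice[bd bdP] (af : K * (K -> K)) : exists b, forall x, (x <= af.1)%O ->
    (af.2 x < b)%O by exact: below_bounded.
pose step a (rec : forall a', (a' < a)%O -> K) :=
  bd (a, fun a' => if pselect (a' < a)%O is left h then c a' (rec a' h) else a).
have stepE a (f g : forall a', (a' < a)%O -> K) :
    (forall a' h, f a' h = g a' h) -> step a f = step a g.
  move=> fg; rewrite /step; congr (bd (_, _)); apply/funext => a'.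
  by case: pselect => // h; rewrite fg.
pose B := Fix (lt_wf regK) (fun=> K) step.
have BE a : B a = step a (fun a' _ => B a') by apply: (Fix_eq (lt_wf regK) (fun=> K) step stepE).
exists B => a' a a'a; rewrite [B a]BE.
pose f a' := if pselect (a' < a)%O is left h then c a' (B a') else a.
by have := bdP (a, f) a' (ltW a'a); rewrite /f /=; case: pselect.
Qed.

Lemma inj_above (b : K) : exists j : K -> K, injective j /\ forall y, (b < j y)%O.
Proof.
have cof : cofinal [set y : K | (b < y)%O].
  move=> x; have [y] := no_max regK (Order.max x b).
  by rewrite gt_max => /andP[xy yb]; exists y => //; apply: ltW.
case: regK => _ _ /(_ _ cof)/card_esym/(card_eq_bijE (k0 regK))[j [jf ji _]].
exists j; split; last by move=> y; apply: jf.
by move=> x y; apply: ji; rewrite inE.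
Qed.

(** The fibres are placed in [K] one after another: the fibre over [a] goes above [B a], and [B a]
    exceeds the images of all earlier fibres. *)
Lemma small_fibres_inj (X : Type) (rho : X -> K) :
  (forall a, small [set x | rho x = a]) -> exists J : X -> K, injective J.
Proof.
move=> sm.
have /choice[i iP] a : exists i : X -> K, forall x y, rho x = a -> rho y = a ->
    i x = i y -> x = y.
  have [b] := sm a; have [le _] := powK b.
  move=> /card_le_trans/(_ le)/(card_le_injE (k0 regK))[f [_ fi]].
  by exists f => x y; apply: fi.
have /choice[j jP] := inj_above.
have /choice[c cP] (ab : K * K) : exists b, forall x, rho x = ab.1 ->
    (j ab.2 (i ab.1 x) < b)%O.
  exact: (fun_bounded regK powK (fun x => j ab.2 (i ab.1 x)) (sm ab.1)).
have [B BP] := wf_choice_bound (fun a b => c (a, b)).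
have lt x y : (rho x < rho y)%O ->
    (j (B (rho x)) (i (rho x) x) < j (B (rho y)) (i (rho y) y))%O.
  move=> xy; apply: lt_trans (cP (_, _) x erefl) _.
  by apply: lt_trans (BP _ _ xy) _; have [] := jP (B (rho y)).
exists (fun x => j (B (rho x)) (i (rho x) x)) => x y e.
have [xy|yx|xy] := ltgtP (rho x) (rho y).
- by have := lt _ _ xy; rewrite e ltxx.
- by have := lt _ _ yx; rewrite e ltxx.
- by rewrite xy in e; have [ji _] := jP (B (rho y)); apply: iP (ji _ _ e).
Qed.

(** Every sequence is bounded by regularity, and the sequences with a given bound form a small
    set. *)
Lemma seq_inj : exists J : (nat -> K) -> K, injective J.
Proof.
have /choice[rho rhoP] := nat_bounded regK powK.
apply: (small_fibres_inj (rho := rho)) => a; exists a.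
by apply: subset_card_le => f <- n; apply: rhoP.
Qed.

Lemma nat_inj : exists i : nat -> K, injective i.
Proof.
by case: regK => _ /infiniteP/(card_le_injE (k0 regK))[i [_ ii]] _;
  exists i => m n; apply: ii.
Qed.

End Power.

(** * The coordinate group *)

Definition eventually_zero : {pred nat -> int} :=
  fun x => `[< exists N, forall n, (N <= n)%N -> x n = 0 >].

Lemma eventually_zeroP x :
  reflect (exists N, forall n, (N <= n)%N -> x n = 0) (x \in eventually_zero).
Proof. exact: asboolP. Qed.

Lemma eventually_zero_closed : zmod_closed eventually_zero.
Proof.
split; first by apply/eventually_zeroP; exists 0%N.
move=> x y /eventually_zeroP[N xN] /eventually_zeroP[N' yN].
apply/eventually_zeroP; exists (maxn N N') => n; rewrite geq_max => /andP[nN nN'].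
by rewrite -[LHS]/(x n - y n) xN ?yN ?subrr.
Qed.

HB.instance Definition _ :=
  GRing.isZmodClosed.Build (nat -> int) eventually_zero eventually_zero_closed.

Local Open Scope quotient_scope.

Lemma pi_quot0 (V : zmodType) (I : zmodClosed V) (x : V) :
  (\pi_({ideal_quot I}) x == 0) = (x \in I).
Proof. by rewrite -[X in _ = (X \in _)]subr0 Quotient.idealrBE raddf0. Qed.

(* Z^omega modulo the eventually zero sequences.  It need not be reduced: only
   torsion-freeness, the purity of 1 and the sums [sum_germ] matter. *)
Definition germ : zmodType := {ideal_quot eventually_zero}.

Lemma pi_germ0 (x : nat -> int) :
  (\pi_germ x = 0) <-> exists N, forall n, (N <= n)%N -> x n = 0.
Proof.
by rewrite (rwP eqP) pi_quot0; split=> /eventually_zeroP.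
Qed.

Lemma mulrnfctE (T : Type) (V : zmodType) (f : T -> V) n t : (f *+ n) t = f t *+ n.
Proof. by elim: n => [|n IH] //; rewrite !mulrS -IH. Qed.

Lemma mulrzfctE (T : Type) (V : zmodType) (f : T -> V) n t : (f *~ n) t = f t *~ n.
Proof.
by case: n => n /=; rewrite ?NegzE ?mulrNz -?pmulrn -?[LHS]/(- (f *+ n.+1) t) mulrnfctE.
Qed.

Lemma sumfctE (T I : Type) (V : zmodType) (r : seq I) (F : I -> T -> V) t :
  (\sum_(i <- r) F i) t = \sum_(i <- r) F i t.
Proof. by elim: r => [|i r IH]; rewrite ?big_nil// !big_cons -IH. Qed.

Lemma germ_torsion_free : torsion_free germ.
Proof.
move=> x n n0; rewrite -[x]reprK -raddfMn => /pi_germ0[N hN].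
apply/pi_germ0; exists N => k /hN; rewrite mulrnfctE => /eqP.
by rewrite mulrn_eq0 -leqn0 leqNgt n0 => /eqP.
Qed.

Definition one_germ : germ := \pi_germ (fun=> 1).

Lemma one_germ_mulz k : one_germ *~ k = \pi_germ (fun=> k).
Proof.
rewrite /one_germ -raddfMz; congr \pi; apply/funext => n.
by rewrite mulrzfctE mulrzz mul1r.
Qed.

Lemma one_germ_inj k : one_germ *~ k = 0 -> k = 0.
Proof. by rewrite one_germ_mulz => /pi_germ0[N] /(_ N (leqnn N)). Qed.

(** From some [N] on, every coordinate of [f] is the same quotient of [k] by [n], so [f N] is the
    multiplier. *)
Lemma one_germ_pure x n k : (0 < n)%N -> x *+ n = one_germ *~ k ->
  exists j, x = one_germ *~ j.
Proof.
move=> n0; rewrite -[x]reprK; set f := repr x => e.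
have /pi_germ0[N hN] : \pi_germ (f *+ n - (fun=> k)) = 0.
  by rewrite raddfB /= raddfMn /= e one_germ_mulz subrr.
exists (f N); apply/eqP; rewrite -subr_eq0; apply/eqP.
apply: (@germ_torsion_free _ n n0); rewrite mulrnBl e !one_germ_mulz -raddfMn -raddfB.
apply/pi_germ0; exists N => i _; have := hN N (leqnn N).
rewrite -[X in X = _]/((f *+ n) N - k) mulrnfctE => /eqP; rewrite subr_eq0 => /eqP fk.
by rewrite -[LHS]/(k - ((fun=> f N) *+ n) i) mulrnfctE fk subrr.
Qed.

Lemma fact_dvd m n : (m <= n)%N -> (m`! %| n`!)%N.
Proof.
by move=> mn; rewrite -(ffact_fact (leq_subr m n)) subKn // dvdn_mull.
Qed.

(** The sequence of partial sums stands for the infinite sum of the [l! c_l]. *)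
Definition sum_germ (c : nat -> int) : germ :=
  \pi_germ (fun N => \sum_(l < N) c l * (l`!)%:Z).

(** From index [N] on, every summand is divisible by [N!], so the tail can be divided termwise. *)
Lemma sum_germ_approx c N : exists w,
  sum_germ c = one_germ *~ (\sum_(l < N) c l * (l`!)%:Z) + w *+ N`!.
Proof.
pose f n := (\sum_(N <= l < n) c l * (l`! %/ N`!)%:Z).
exists (\pi_germ f); rewrite one_germ_mulz -raddfMn -raddfD /=.
apply/eqP; rewrite -subr_eq0 -raddfB; apply/eqP/pi_germ0; exists N => n Nn.
rewrite -[LHS]/(_ - (_ + (f *+ N`!) n)) mulrnfctE /f.
rewrite -(big_mkord xpredT (fun l => c l * (l`!)%:Z)) (big_cat_nat (n := N)) //=.
rewrite big_mkord opprD addrA [X in X + _](_ : _ = \sum_(N <= l < n) c l * (l`!)%:Z); last first.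
  by rewrite [in X in X - _]addrC addrK.
apply/eqP; rewrite subr_eq0; apply/eqP; rewrite -sumrMnl.
apply: eq_big_nat => l /andP[Nl _]; rewrite -mulrnAr; congr (_ * _).
by rewrite -mulr_natr natz -PoszM divnK // fact_dvd.
Qed.

(* A function of countable support is coded by an enumeration of its support
   interleaved with the digits of its values there. *)
Lemma countable_support_code (d : Order.disp_t) (K : orderType d) (iota : nat -> K) :
  injective iota -> exists enc : (K -> germ) -> nat -> K,
    (forall x y, countable [set p | x p <> 0] -> countable [set p | y p <> 0] ->
       enc x = enc y -> x = y) /\
    (forall x a, (forall p, x p <> 0 -> (p < a)%O) -> (forall n, (iota n < a)%O) ->
       forall n, (enc x n < a)%O).
Proof.
move=> ii.
have /choice[q qP] (x : K -> germ) : exists q : nat -> K,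
    (countable [set p | x p <> 0] -> forall p, x p <> 0 -> exists i, p = q i) /\
    (forall i, x (q i) <> 0 \/ q i = iota 0).
  have [cx|ncx] := pselect (countable [set p | x p <> 0]); last first.
    by exists (fun=> iota 0); split => // i; right.
  have /(card_le_injE 0%N)[f [_ fi]] := cx.
  (* Indices enumerating no point of the support get the default [iota 0], which lies below every
     bound of [iota] and so keeps the code bounded. *)
  have /choice[q qP] i : exists p, (x p <> 0 /\ f p = i) \/
      (p = iota 0 /\ forall p', x p' <> 0 -> f p' <> i).
    have [[p hp]|no] := pselect (exists p, x p <> 0 /\ f p = i); first by exists p; left.
    by exists (iota 0); right; split => // p' xp' fp'; apply: no; exists p'.
  exists q; split.
    move=> _ p xp; exists (f p); have [[xq fq]|[_ /(_ p xp)//]] := qP (f p).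
    by apply: fi => //; rewrite fq.
  by move=> i; have [[]|[]] := qP i; [left|right].
pose ent x (t : nat * option nat) : K :=
  if t.2 is Some j then iota (pickle (repr (x (q x t.1)) j)) else q x t.1.
exists (fun x l => if pickle_inv l is Some t then ent x t else iota 0); split.
- move=> x y cx cy e.
  have E t : ent x t = ent y t.
    by have := congr1 (@^~ (pickle t)) e; rewrite pickleK_inv.
  have qE i : q x i = q y i := E (i, None).
  have vE i : x (q x i) = y (q x i).
    rewrite -[LHS]reprK -[RHS]reprK; congr \pi; apply/funext => j.
    have /ii/(pcan_inj pickleK) := E (i, Some j).
    by rewrite /= -qE.
  apply/funext => p; have [xp|xp] := pselect (x p = 0); last first.
    by have [h _] := qP x; have [i ->] := h cx p xp.
  have [yp|yp] := pselect (y p = 0); first by rewrite xp yp.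
  by have [h _] := qP y; have [i pi] := h cy p yp; rewrite pi -qE.
- move=> x a xa ia l; case: pickle_inv => // -[i [j|]]; rewrite /ent //=.
  by have [_ /(_ i)[/xa//|->]] := qP x.
Qed.

Local Close Scope quotient_scope.

(** * Pure closures and integral functionals *)

Section PureClosure.
Variable V : zmodType.
Implicit Types (x y z w : V) (L S : seq V) (phi rho : V -> int).

Fixpoint zspan L x : Prop :=
  if L is g :: L' then exists k, zspan L' (x - g *~ k) else x = 0.

(** The pure closure of the subgroup generated by [L]. *)
Definition pure_span L x := exists2 n, (0 < n)%N & zspan L (x *+ n).

Lemma zspan_sub L x y : zspan L x -> zspan L y -> zspan L (x - y).
Proof.
elim: L x y => [|g L IH] x y /=; first by move=> -> ->; rewrite subrr.
move=> [k hk] [j hj]; exists (k - j); have := IH _ _ hk hj.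
by rewrite mulrzBr !opprB [g *~ j - y]addrC addrACA [- (g *~ k) + _]addrC.
Qed.

Lemma zspan0 L : zspan L 0.
Proof. by elim: L => //= g L IH; exists 0; rewrite mulr0z subrr. Qed.

Lemma zspanN L x : zspan L x -> zspan L (- x).
Proof. by move=> ?; rewrite -sub0r; apply: zspan_sub => //; exact: zspan0. Qed.

Lemma zspanD L x y : zspan L x -> zspan L y -> zspan L (x + y).
Proof. by move=> ? ?; rewrite -[y]opprK; apply: zspan_sub => //; exact: zspanN. Qed.

Lemma zspanMn L x n : zspan L x -> zspan L (x *+ n).
Proof.
by move=> hx; elim: n => [|n IH]; rewrite ?mulr0n ?mulrS; [exact: zspan0|exact: zspanD].
Qed.

Lemma zspanMz L x k : zspan L x -> zspan L (x *~ k).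
Proof.
by case: k => n hx; rewrite ?NegzE ?mulrNz; [exact: zspanMn|apply: zspanN; exact: zspanMn].
Qed.

Lemma zspan_mem L x : x \in L -> zspan L x.
Proof.
elim: L => // g L IH; rewrite inE => /orP[/eqP ->|/IH hx] /=.
  by exists 1; rewrite mulr1z subrr; exact: zspan0.
by exists 0; rewrite mulr0z subr0.
Qed.

Lemma zspan_trans S L x : (forall y, y \in S -> zspan L y) -> zspan S x -> zspan L x.
Proof.
elim: S x => [|g S IH] x /= SL; first by move=> ->; exact: zspan0.
move=> [k hk]; rewrite -(subrK (g *~ k) x); apply: zspanD.
  by apply: IH hk => y yS; apply: SL; rewrite inE yS orbT.
by apply: zspanMz; apply: SL; rewrite inE eqxx.
Qed.

Lemma pure_spanW L x : zspan L x -> pure_span L x.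
Proof. by exists 1%N. Qed.

Lemma pure_span0 L : pure_span L 0.
Proof. by apply: pure_spanW; exact: zspan0. Qed.

Lemma pure_span_mem L x : x \in L -> pure_span L x.
Proof. by move=> /zspan_mem; exact: pure_spanW. Qed.

Lemma pure_span_sub L x y : pure_span L x -> pure_span L y -> pure_span L (x - y).
Proof.
move=> [m m0 hx] [n n0 hy]; exists (m * n)%N; first by rewrite muln_gt0 m0.
rewrite mulrnBl; apply: zspan_sub; last rewrite mulnC; rewrite mulrnA; exact: zspanMn.
Qed.

Lemma pure_spanN L x : pure_span L x -> pure_span L (- x).
Proof. by move=> ?; rewrite -sub0r; apply: pure_span_sub => //; exact: pure_span0. Qed.

Lemma pure_spanD L x y : pure_span L x -> pure_span L y -> pure_span L (x + y).
Proof. by move=> ? ?; rewrite -[y]opprK; apply: pure_span_sub => //; exact: pure_spanN. Qed.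

Lemma pure_spanMz L x k : pure_span L x -> pure_span L (x *~ k).
Proof.
move=> [m m0 hx]; exists m => //.
by rewrite pmulrn mulrzAC -pmulrn; exact: zspanMz.
Qed.

Lemma pure_span_divz L x k : k != 0 -> pure_span L (x *~ k) -> pure_span L x.
Proof.
move=> k0 [m m0]; rewrite pmulrn -mulrzA => hx; exists (`|k| * m)%N.
  by rewrite muln_gt0 absz_gt0 k0.
rewrite pmulrn PoszM abszE; case: (ger0P k) => _; first by [].
by rewrite mulNr mulrNz; exact: zspanN.
Qed.

Lemma pure_span_divn L x n : (0 < n)%N -> pure_span L (x *+ n) -> pure_span L x.
Proof. by move=> n0; rewrite pmulrn; apply: pure_span_divz; rewrite eqz_nat -lt0n. Qed.

Lemma pure_span_trans S L x : (forall y, y \in S -> pure_span L y) ->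
  pure_span S x -> pure_span L x.
Proof.
move=> SL [m m0 hx]; apply: (pure_span_divn m0).
elim: S (x *+ m) SL hx => [|g S IH] y /= SL; first by move=> ->; exact: pure_span0.
move=> [k hk]; rewrite -(subrK (g *~ k) y); apply: pure_spanD.
  by apply: IH hk => z zS; apply: SL; rewrite inE zS orbT.
by apply: pure_spanMz; apply: SL; rewrite inE eqxx.
Qed.

Lemma pure_span_sub_mem S L x : {subset S <= L} -> pure_span S x -> pure_span L x.
Proof. by move=> SL; apply: pure_span_trans => y /SL; exact: pure_span_mem. Qed.

Definition additive_on L phi := forall x y, pure_span L x -> pure_span L y ->
  phi (x + y) = phi x + phi y.

Section AdditiveOn.
Variables (L : seq V) (phi : V -> int).
Hypothesis addphi : additive_on L phi.

Lemma additive_on0 : phi 0 = 0.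
Proof.
have := addphi (pure_span0 L) (pure_span0 L); rewrite addr0 => e.
by apply: (addrI (phi 0)); rewrite addr0 -e.
Qed.

Lemma additive_onN x : pure_span L x -> phi (- x) = - phi x.
Proof.
move=> hx; apply/eqP; rewrite -addr_eq0 -addphi //; last exact: pure_spanN.
by rewrite addNr additive_on0.
Qed.

Lemma additive_onB x y : pure_span L x -> pure_span L y ->
  phi (x - y) = phi x - phi y.
Proof. by move=> hx hy; rewrite addphi ?additive_onN //; exact: pure_spanN. Qed.

Lemma additive_onMn x n : pure_span L x -> phi (x *+ n) = phi x *+ n.
Proof.
move=> hx; elim: n => [|n IH]; first by rewrite !mulr0n additive_on0.
by rewrite !mulrS addphi ?IH // pmulrn; exact: pure_spanMz.
Qed.

Lemma additive_onMz x k : pure_span L x -> phi (x *~ k) = phi x * k.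
Proof.
move=> hx; rewrite -mulrzz; case: k => n; first exact: additive_onMn.
rewrite NegzE !mulrNz -!pmulrn additive_onN ?additive_onMn //.
by rewrite pmulrn; exact: pure_spanMz.
Qed.

Lemma additive_on_vanish S x : (forall y, y \in S -> pure_span L y) ->
  (forall y, y \in S -> phi y = 0) -> pure_span S x -> phi x = 0.
Proof.
move=> SL S0 hx; have hxL := pure_span_trans SL hx.
case: hx => m m0 hx; apply/eqP.
suff : phi (x *+ m) == 0.
  by rewrite additive_onMn // mulrn_eq0 -leqn0 leqNgt m0.
elim: S (x *+ m) SL S0 hx => [|g S IH] y /= SL S0.
  by move=> ->; rewrite additive_on0.
move=> [k hk].
have SL' z : z \in S -> pure_span L z by move=> zS; apply: SL; rewrite inE zS orbT.
have gL : pure_span L g by apply: SL; rewrite inE eqxx.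
rewrite -(subrK (g *~ k) y) addphi; last exact: pure_spanMz.
  rewrite additive_onMz // (S0 g) ?inE ?eqxx // mul0r addr0; apply: IH => // z zS.
  by apply: S0; rewrite inE zS orbT.
by apply: pure_span_trans (pure_spanW hk).
Qed.

End AdditiveOn.

(* Z-valued functionals on the pure closure of L separate every point from every
   finite set it does not depend on; this expresses that the closure is free of
   finite rank. *)
Definition separated L := forall S z, (forall x, x \in S -> pure_span L x) ->
  pure_span L z -> ~ pure_span S z ->
  exists phi, [/\ additive_on L phi, forall x, x \in S -> phi x = 0 & phi z <> 0].

Lemma separated_eq L L' : {subset L <= L'} -> {subset L' <= L} ->
  separated L -> separated L'.
Proof.
move=> LL' L'L sL S z SL zL nz.
have h x : pure_span L' x -> pure_span L x by exact: pure_span_sub_mem.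
have [|//|//|phi [a b c]] := sL S z; [by move=> x /SL /h|exact: h|].
by exists phi; split => // x y /h hx /h hy; exact: a.
Qed.

Lemma separated_nil : separated [::].
Proof.
move=> S z _ [n n0 /= e] []; exists n => //; rewrite e; exact: zspan0.
Qed.

(** Given [w] with [rho w <> 0], the map [T x = rho(w) x - rho(x) w] sends the larger pure closure
    into the kernel of [rho], hence into that of [L]; a functional separating there is pulled back
    along [T]. *)
Lemma separated_cons g L rho : additive_on (g :: L) rho ->
  (forall x, pure_span (g :: L) x -> rho x = 0 -> pure_span L x) ->
  rho g <> 0 -> separated L -> separated (g :: L).
Proof.
move=> arho krho rhog sL S z SL zL nz.
(* The element [w] is taken in [S] if [rho] is nonzero somewhere on [S]. Otherwise [rho] itself
   separates [z], or it vanishes on [z :: S] and [w = g] serves. *)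
suff core w : pure_span (g :: L) w -> rho w <> 0 ->
    (forall x, x \in z :: S -> pure_span S (w *~ rho x)) ->
    exists phi, [/\ additive_on (g :: L) phi, forall x, x \in S -> phi x = 0 & phi z <> 0].
  have [[w wS rw]|no] := pselect (exists2 w, w \in S & rho w <> 0).
    apply: (core w) => //; first exact: SL.
    by move=> x _; apply: pure_spanMz; exact: pure_span_mem.
  have S0 x : x \in S -> rho x = 0.
    by move=> xS; apply: contrapT => h; apply: no; exists x.
  have [rz|rz] := pselect (rho z = 0); last by exists rho; split.
  apply: (core g) => //; first by apply: pure_span_mem; rewrite inE eqxx.
  move=> x; rewrite inE => /orP[/eqP ->|/S0 ->]; rewrite ?rz mulr0z;
  exact: pure_span0.
move=> wL rw wS; pose T x := x *~ rho w - w *~ rho x.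
have TL x : pure_span (g :: L) x -> pure_span L (T x).
  move=> hx; apply: krho.
    by apply: pure_span_sub; exact: pure_spanMz.
  rewrite (additive_onB arho); try exact: pure_spanMz.
  by rewrite !(additive_onMz arho) // mulrC subrr.
have [|||phi' [aphi S0 z0]] := sL (map T S) (T z).
- by move=> _ /mapP[x xS ->]; apply: TL; exact: SL.
- exact: TL.
- move=> h; apply: nz; apply: (@pure_span_divz _ _ (rho w)); first exact/eqP.
  rewrite -(subrK (w *~ rho z) (z *~ rho w)); apply: pure_spanD; last first.
    by apply: wS; rewrite inE eqxx.
  apply: pure_span_trans h => _ /mapP[x xS ->].
  apply: pure_span_sub; first by apply: pure_spanMz; exact: pure_span_mem.
  by apply: wS; rewrite inE xS orbT.
exists (phi' \o T); split => [x y hx hy|x xS|//] /=; last by apply: S0; exact: map_f.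
rewrite -aphi; try exact: TL.
by congr phi'; rewrite /T arho // mulrzDl mulrzDr opprD addrACA.
Qed.

(** As [res] kills [L] and sends [g] to a nonzero multiple of [v], the functional [phi \o res] is
    nonzero at [g] and its kernel is the pure closure of [L]. *)
Lemma separated_cons_restr g L (res : {additive V -> V}) v N phi : N != 0 ->
  res g = v *~ N -> (forall x, x \in L -> res x = 0) -> additive_on [:: v] phi ->
  phi v <> 0 -> separated L -> separated (g :: L).
Proof.
move=> N0 rg rL aphi phiv.
have resL x : zspan L x -> res x = 0.
  elim: L x rL => [|h L IH] x rL /=; first by move=> ->; rewrite raddf0.
  move=> [k /IH]; rewrite raddfB raddfMz /= (rL h) ?inE ?eqxx // mul0rz subr0.
  by apply=> y yL; apply: rL; rewrite inE yL orbT.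
have vv : pure_span [:: v] v by apply: pure_span_mem; rewrite inE.
have resP x m j : zspan L (x *+ m - g *~ j) -> res x *+ m = v *~ (N * j).
  move=> /resL; rewrite raddfB raddfMn raddfMz /= rg -mulrzA => /eqP.
  by rewrite subr_eq0 => /eqP.
have resS x : pure_span (g :: L) x -> pure_span [:: v] (res x).
  move=> [m m0 /= [j /resP hj]]; apply: (pure_span_divn m0); rewrite hj.
  exact: pure_spanMz.
apply: (@separated_cons _ _ (phi \o res)) => /=.
- by move=> x y hx hy /=; rewrite raddfD aphi //; exact: resS.
- move=> x hx x0; have := resS x hx; case: hx => m m0 [j hj] hx.
  have := additive_onMn aphi m hx.
  rewrite (resP _ _ _ hj) x0 mul0rn (additive_onMz aphi) // => /eqP.
  rewrite !mulf_eq0 (negbTE (introN eqP phiv)) (negbTE N0) /= => /eqP j0.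
  by exists m => //; move: hj; rewrite j0 mulr0z subr0.
- rewrite rg (additive_onMz aphi) //; apply/eqP.
  by rewrite mulf_eq0 negb_or N0 andbT; exact/eqP.
Qed.

End PureClosure.

Lemma seq_has_max (T : eqType) (R : T -> T -> Prop) (s : seq T) :
  (forall x y, R x y \/ R y x) -> (forall y x z, R x y -> R y z -> R x z) ->
  s <> [::] -> exists2 w, w \in s & forall v, v \in s -> R v w.
Proof.
move=> tot tr; have rR x : R x x by have [] := tot x x.
elim: s => // a [|a' s] IH _.
  by exists a; [rewrite inE|move=> v; rewrite inE => /eqP ->].
have [//|w ws wm] := IH.
have [aw|wa] := tot a w.
  exists w; first by rewrite inE ws orbT.
  by move=> v; rewrite inE => /orP[/eqP ->|/wm].
exists a; first by rewrite inE eqxx.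
by move=> v; rewrite inE => /orP[/eqP ->//|/wm h]; apply: tr wa.
Qed.

(** * Freeness of countable subgroups by Pontryagin's criterion *)

Section ZSpan.
Variables (V : zmodType) (B : set V).

Definition uniq_span (x : V) := exists (s : seq V) (c : V -> int),
  [/\ uniq s, forall b, b \in s -> B b & x = \sum_(b <- s) b *~ c b].

Lemma uniq_span0 : uniq_span 0.
Proof. by exists [::], (fun=> 0); split=> //; rewrite big_nil. Qed.

Lemma uniq_span_add x b k : B b -> uniq_span x -> uniq_span (x + b *~ k).
Proof.
move=> Bb [s [c [us sB ->]]].
case: (boolP (b \in s)) => bs.
  exists s, (fun v => if v == b then c b + k else c v); split => //.
  rewrite (bigD1_seq b) //= [in RHS](bigD1_seq b) //= eqxx mulrzDr addrAC.
  by congr (_ + _); apply: eq_bigr => v /negPf ->.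
exists (b :: s), (fun v => if v == b then k else c v); split.
- by rewrite /= bs.
- by move=> v; rewrite inE => /orP[/eqP ->|/sB].
- rewrite big_cons eqxx addrC; congr (_ + _); apply: eq_big_seq => v vs.
  by case: eqP => // vb; rewrite -vb vs in bs.
Qed.

End ZSpan.

Section CountableFree.
Variable V : zmodType.
Hypothesis tfV : torsion_free V.
Hypothesis sepV : forall (S : seq V) z, ~ pure_span S z -> exists phi,
  [/\ additive_on (z :: S) phi, forall x, x \in S -> phi x = 0 & phi z <> 0].
Variable U : zmodClosed V.

(* Above the part already generated, [U] meets the pure closure of one more
   element in an infinite cyclic group: the values of [phi] on it form a
   nonzero subgroup of Z. *)
Lemma next_generator S e : (forall x, x \in S -> x \in U) -> e \in U ->
  exists b, [/\ b \in U, pure_span (e :: S) b,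
    (forall x, x \in U -> pure_span (e :: S) x ->
       exists k, pure_span S (x - b *~ k)) & (b = 0 \/ ~ pure_span S b)].
Proof.
move=> SU eU; have [eS|neS] := pselect (pure_span S e).
  exists 0; split; [exact: rpred0|exact: pure_span0| |by left].
  move=> x _ hx; exists 0; rewrite mulr0z subr0; apply: pure_span_trans hx => y.
  by rewrite inE => /orP[/eqP ->//|]; exact: pure_span_mem.
have [phi [aphi S0 e0]] := sepV neS.
have SL y : y \in S -> pure_span (e :: S) y.
  by move=> yS; apply: pure_span_mem; rewrite inE yS orbT.
have eL : pure_span (e :: S) e by apply: pure_span_mem; rewrite inE eqxx.
have ker x : pure_span (e :: S) x -> phi x = 0 -> pure_span S x.
  move=> hx x0; case: (hx) => m m0 /= [k hk]; apply: (pure_span_divn m0).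
  have := additive_on_vanish aphi SL S0 (pure_spanW hk).
  have xm : pure_span (e :: S) (x *+ m) by rewrite pmulrn; exact: pure_spanMz.
  rewrite (additive_onB aphi) //; last exact: pure_spanMz.
  rewrite (additive_onMn aphi) // (additive_onMz aphi) // x0 mul0rn sub0r.
  move=> /eqP; rewrite oppr_eq0 mulf_eq0 (negbTE (introN eqP e0)) /= => /eqP k0.
  by move: hk; rewrite k0 mulr0z subr0; exact: pure_spanW.
pose Q n := `[< exists b, [/\ b \in U, pure_span (e :: S) b & phi b = n.+1%:Z] >].
have exQ : exists n, Q n.
  have [] := ltP 0 (phi e) => h.
    exists (`|phi e|.-1)%N; apply/asboolP; exists e; split => //.
    by rewrite prednK ?absz_gt0 ?gt_eqF // gtz0_abs.
  exists (`|phi e|.-1)%N; apply/asboolP; exists (- e); split; [by rewrite rpredN|exact: pure_spanN|].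
  rewrite prednK ?absz_gt0; last exact/eqP.
  by rewrite (additive_onN aphi) // lez0_abs.
case: (ex_minnP exQ) => n /asboolP[b [bU bL bn]] nmin.
exists b; split => //; last first.
  by right=> /(additive_on_vanish aphi SL S0); rewrite bn.
(* The remainder modulo the least positive value [n.+1] is again a value of [phi] on [U], hence
   zero. *)
move=> x xU xL; exists (phi x %/ n.+1)%Z.
have rL : pure_span (e :: S) (x - b *~ (phi x %/ n.+1)%Z).
  by apply: pure_span_sub => //; exact: pure_spanMz.
have re : phi (x - b *~ (phi x %/ n.+1)%Z) = (phi x %% n.+1)%Z.
  rewrite (additive_onB aphi) //; last exact: pure_spanMz.
  by rewrite (additive_onMz aphi) // bn mulrC {1}(divz_eq (phi x) n.+1) addrAC subrr add0r.
apply: ker => //; rewrite re.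
have : (0 <= (phi x %% n.+1)%Z) by rewrite modz_ge0.
have := ltz_pmod (phi x) (isT : 0 < n.+1%:Z).
case rx : (phi x %% n.+1)%Z => [[|r]|] // rn _.
have /nmin : Q r.
  apply/asboolP; exists (x - b *~ (phi x %/ n.+1)%Z); split => //; last by rewrite re rx.
  by rewrite rpredB // rpredMz.
by move: rn; rewrite ltz_nat ltnS => rn; rewrite leqNgt rn.
Qed.

(** Along an enumeration of [U], the trace on [U] of the pure closure of an initial segment grows by
    at most one cyclic summand at a time; the nonzero generators form a basis. *)
Lemma countable_free : countable [set` U] -> free_subgroup U.
Proof.
move=> cU.
have [e [eU eS]] : exists e : nat -> V, (forall n, e n \in U) /\
    (forall x, x \in U -> exists n, x = e n).
  have /(card_le_injE 0%N)[f [_ fi]] := cU.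
  have /choice[e eP] n : exists v, v \in U /\ (forall x, x \in U -> f x = n -> x = v).
    have [[v [vU vn]]|no] := pselect (exists v, v \in U /\ f v = n).
      by exists v; split => // x xU xn; apply: fi => //; rewrite xn.
    by exists 0; split; [exact: rpred0|move=> x xU xn; case: no; exists x].
  exists e; split=> [n|x xU]; first by have [] := eP n.
  by exists (f x); have [_] := eP (f x); apply.
pose S n := rev (mkseq e n).
have SS n : S n.+1 = e n :: S n by rewrite /S mkseqS rev_rcons.
have SU n x : x \in S n -> x \in U.
  by rewrite mem_rev => /mapP[i _ ->].
have Smono m n x : (m <= n)%N -> pure_span (S m) x -> pure_span (S n) x.
  move=> mn; apply: pure_span_sub_mem => y; rewrite !mem_rev => /mapP[i].
  rewrite mem_iota add0n => /andP[_ im] ->; apply: map_f.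
  by rewrite mem_iota add0n (leq_trans im mn).
have /choice[b bP] n : exists b, [/\ b \in U, pure_span (S n.+1) b,
    (forall x, x \in U -> pure_span (S n.+1) x -> exists k, pure_span (S n) (x - b *~ k)) &
    (b = 0 \/ ~ pure_span (S n) b)].
  by rewrite SS; apply: next_generator => //; exact: SU.
pose B := [set v | exists n, v = b n /\ b n <> 0].
have BU v : B v -> v \in U by move=> [n [-> _]]; have [] := bP n.
exists B; split.
- move=> s c us sB sum0 v vs; apply: contrapT => cv.
  have /choice[i iP] w : exists i, B w -> w = b i /\ b i <> 0.
    by have [[i ?]|no] := pselect (B w); [exists i|exists 0%N].
  have iE w : w \in s -> w = b (i w) /\ b (i w) <> 0 by move=> /sB/iP.
  pose t := [seq w <- s | c w != 0].
  have ts w : w \in t -> w \in s by rewrite mem_filter => /andP[].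
  (* In a nontrivial relation the generator of largest index would lie in the pure closure of the
     earlier segment. *)
  have [w wt wmax] : exists2 w, w \in t & forall w', w' \in t -> (i w' <= i w)%N.
    apply: (seq_has_max (R := fun x y => i x <= i y)%N).
    - by move=> x y; apply/orP; exact: leq_total.
    - by move=> y x z; exact: leq_trans.
    - move=> t0; suff : v \in t by rewrite t0.
      by rewrite mem_filter vs andbT; exact/eqP.
  have [wE w0] := iE w (ts _ wt); have [_ _ _ [//|nS]] := bP (i w).
  apply: nS; rewrite -wE; apply: (@pure_span_divz _ _ _ (c w)).
    by move: wt; rewrite mem_filter => /andP[].
  move: sum0; rewrite (bigD1_seq w) //=; last exact: ts.
  move=> /eqP; rewrite addr_eq0 => /eqP ->; apply: pure_spanN.
  rewrite big_seq_cond; elim/big_ind: _ => [||w' /andP[w's w'w]]; first exact: pure_span0.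
    by move=> ? ?; exact: pure_spanD.
  have [cw'|cw'] := eqVneq (c w') 0; first by rewrite cw' mulr0z; exact: pure_span0.
  have w't : w' \in t by rewrite mem_filter cw'.
  have [w'E _] := iE w' w's.
  apply: pure_spanMz; rewrite w'E; have [_ h _ _] := bP (i w').
  apply: Smono h; rewrite ltn_neqAle wmax // andbT; apply/eqP => ii.
  by move: w'w; rewrite w'E ii -wE eqxx.
- apply/seteqP; split=> x /=.
    move=> [s [c [sB ->]]]; rewrite big_seq; apply: rpred_sum => v vs.
    by rewrite rpredMz //; apply: BU; exact: sB.
  move=> xU; suff [s [c [_ sB ->]]] : uniq_span B x by exists s, c.
  have [n xn] := eS x xU.
  have : pure_span (S n.+1) x by rewrite SS; apply: pure_span_mem; rewrite inE xn eqxx.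
  elim: n.+1 x xU {xn} => {n}[|n IH] x xU.
    move=> [m m0 /= e0]; rewrite (tfV m0 e0); exact: uniq_span0.
  have [bU _ h _] := bP n => /(h x xU)[k /IH hk].
  rewrite -(subrK (b n *~ k) x).
  have [b0|b0] := pselect (b n = 0); last first.
    apply: uniq_span_add; first by exists n.
    by apply: hk; rewrite rpredB // rpredMz.
  by move: hk; rewrite b0 mul0rz subr0 addr0; apply.
Qed.

End CountableFree.

Lemma injective_subgroup (A H : zmodType) (f : A -> H) : zmod_morphism f ->
  injective f -> has_subgroup_isomorphic_to A H.
Proof.
move=> fB fi.
pose P : {pred H} := fun x => `[< exists a, x = f a >].
have PP x : reflect (exists a, x = f a) (x \in P) by exact: asboolP.
have Pz : zmod_closed P.
  split; first by apply/PP; exists 0; rewrite -[in RHS](subrr 0) fB subrr.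
  by move=> _ _ /PP[a ->] /PP[b ->]; apply/PP; exists (a - b); rewrite fB.
pose V : zmodClosed H := HB.pack P (GRing.isZmodClosed.Build H P Pz).
pose F : {additive A -> H} := HB.pack f (GRing.isZmodMorphism.Build A H f fB).
exists V, F; split.
- by move=> a _ /=; apply/PP; exists a.
- by move=> a b _ _ /fi.
- by move=> x /= /PP[a ->]; exists a.
Qed.

(** * Profinite multiples in cotorsion-free groups *)

Section Reduced.
Variable H : zmodType.
Hypothesis tfH : torsion_free H.
Hypothesis noQ : ~ has_subgroup_isomorphic_to rat H.

Lemma torsion_freez (x : H) k : k != 0 -> x *~ k = 0 -> x = 0.
Proof.
case: k => n n0 e; first by apply: tfH e; rewrite lt0n -eqz_nat.
by apply: (@tfH _ n.+1) => //; apply/eqP; rewrite -oppr_eq0; apply/eqP.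
Qed.

Lemma mulrz_inj (x y : H) k : k != 0 -> x *~ k = y *~ k -> x = y.
Proof.
move=> k0 e; apply/eqP; rewrite -subr_eq0; apply/eqP; apply: torsion_freez k0 _.
by rewrite mulrzBl e subrr.
Qed.

(** If [h] were nonzero, its unique quotients by integers would form a copy of the rationals. *)
Lemma reduced (h : H) : (forall N, exists w, h = w *+ N`!) -> h = 0.
Proof.
move=> hd; apply: contrapT => h0; apply: noQ.
have /choice[q qP] (n : int) : exists z, 0 < n -> z *~ n = h.
  case: n => [[|n]|n]; try by exists 0.
  have [w hw] := hd n.+1; exists (w *+ n`!) => _.
  by rewrite -pmulrn -mulrnA mulnC -factS.
(* The rational [a / b] is sent to the unique solution [y] of [b y = a h]. *)
pose f x : H := q (denq x) *~ numq x.
have fP (a b : int) x : b != 0 -> x = a%:~R / b%:~R -> f x *~ b = h *~ a.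
  move=> b0 xab; apply: (@mulrz_inj _ _ (denq x)); first exact: denq_neq0.
  rewrite /f mulrzAC [in X in X *~ b]mulrzAC qP ?denq_gt0 // -!mulrzA; congr (_ *~ _).
  apply/eqP; rewrite -(eqr_int rat) !intrM numqE xab.
  have bQ : b%:~R != 0 :> rat by rewrite intr_eq0.
  by rewrite mulrAC divfK.
apply: (@injective_subgroup _ _ f).
  move=> x y; have dx := denq_neq0 x; have dy := denq_neq0 y.
  apply: (@mulrz_inj _ _ (denq x * denq y)); first by rewrite mulf_neq0.
  have e1 : f x *~ (denq x * denq y) = h *~ (numq x * denq y).
    by rewrite mulrzA (fP (numq x) (denq x) x) ?divq_num_den // -mulrzA.
  have e2 : f y *~ (denq x * denq y) = h *~ (numq y * denq x).
    have := fP (numq y) (denq y) y dy; rewrite divq_num_den => /(_ erefl) e0.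
    by rewrite [denq x * denq y]mulrC [LHS]mulrzA e0 -mulrzA.
  rewrite mulrzBl e1 e2 (fP (numq x * denq y - numq y * denq x)) ?mulf_neq0 //.
    by rewrite mulrzBr.
  rewrite rmorphB /= !rmorphM /= !numqE.
  have bx : (denq x)%:~R != 0 :> rat by rewrite intr_eq0.
  have by_ : (denq y)%:~R != 0 :> rat by rewrite intr_eq0.
  rewrite -mulrA -[y * _ * _]mulrA [(denq y)%:~R * (denq x)%:~R]mulrC -mulrBl mulfK //.
  by rewrite mulf_neq0.
move=> x y e; rewrite -(divq_num_den x) -(divq_num_den y).
have h1 := fP (numq x) (denq x) x (denq_neq0 x) (esym (divq_num_den x)).
have h2 := fP (numq y) (denq y) y (denq_neq0 y) (esym (divq_num_den y)).
have : h *~ (numq x * denq y - numq y * denq x) = 0.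
  by rewrite mulrzBr mulrzA -h1 mulrzA -h2 e mulrzAC subrr.
have [e0 _|ne /(torsion_freez ne)//] := eqVneq (numq x * denq y - numq y * denq x) 0.
have bx : (denq x)%:~R != 0 :> rat by rewrite intr_eq0 denq_neq0.
have by_ : (denq y)%:~R != 0 :> rat by rewrite intr_eq0 denq_neq0.
apply/eqP; rewrite eqr_div // -!intrM eqr_int -subr_eq0.
exact/eqP.
Qed.

Section PadicHom.
Variable g : H.

(* [h] behaves as the product of [g] by the profinite integer whose residue
   modulo [N!] is [x N]. *)
Definition profinite_multiple (x : nat -> int) h :=
  forall N, exists w, h = g *~ x N + w *+ N`!.

Hypothesis complete_g : forall c : nat -> int,
  exists h, profinite_multiple (fun N => \sum_(l < N) c l * (l`!)%:Z) h.

(** The successive differences of a coherent [x] are the digits [l! c_l]; their partial sums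
    telescope to [x N - x 0]. *)
Lemma profinite_multiple_exists x : (forall N, ((N`!)%:Z %| x N.+1 - x N)%Z) ->
  exists h, profinite_multiple x h.
Proof.
move=> cx; have [h hP] := complete_g (fun l => ((x l.+1 - x l) %/ (l`!)%:Z)%Z).
exists (h + g *~ x 0%N) => N; have [w ->] := hP N; exists w.
rewrite addrAC -mulrzDr; congr (g *~ _ + _).
elim: N {w} => [|N IH]; first by rewrite big_ord0 add0r.
by rewrite big_ord_recr /= addrAC IH divzK // addrC subrK.
Qed.

Lemma profinite_multiple_unique x h h' :
  profinite_multiple x h -> profinite_multiple x h' -> h = h'.
Proof.
move=> hx hx'; apply/eqP; rewrite -subr_eq0; apply/eqP; apply: reduced => N.
have [[w ->] [w' ->]] := (hx N, hx' N); exists (w - w').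
by rewrite opprD addrACA subrr add0r mulrnBl.
Qed.

Lemma profinite_multiple_eqmod x x' h : (forall N, ((N`!)%:Z %| x N - x' N)%Z) ->
  profinite_multiple x h -> profinite_multiple x' h.
Proof.
move=> xx hx N; have [w ->] := hx N; have /dvdzP[k kE] := xx N.
exists (w + g *~ k); rewrite mulrnDl [w *+ _ + _]addrC addrA; congr (_ + _).
by rewrite pmulrn -mulrzA -kE -mulrzDr addrC subrK.
Qed.

Lemma profinite_multipleB x x' h h' : profinite_multiple x h ->
  profinite_multiple x' h' -> profinite_multiple (fun N => x N - x' N) (h - h').
Proof.
move=> hx hx' N; have [[w ->] [w' ->]] := (hx N, hx' N); exists (w - w').
by rewrite opprD addrACA mulrzBr mulrnBl.
Qed.

Lemma divisible_coprime (b q : nat) (w : H) : coprime b q -> (0 < b)%N ->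
  g *+ b = w *+ q -> exists w', g = w' *+ q.
Proof.
move=> cbq b0 e; case: (egcdnP q b0) => u v uv _.
rewrite (eqP cbq) in uv.
have E : g + (g *+ v) *+ q = (w *+ u) *+ q.
  by rewrite -mulrnA -mulrS -add1n addnC -uv mulnC mulrnA e mulrnAC.
by exists (w *+ u - g *+ v); rewrite mulrnBl -E addrK.
Qed.

Lemma divisible_mul (a b : nat) : coprime a b -> (0 < a)%N ->
  (exists w, g = w *+ a) -> (exists w, g = w *+ b) -> exists w, g = w *+ (a * b).
Proof.
move=> cab a0 [w gw] [w' gw'].
case: (egcdnP b a0) => u v uv _; rewrite (eqP cab) in uv.
exists (w' *+ u - w *+ v); rewrite mulrnBl.
have -> : w' *+ u *+ (a * b) = g *+ (u * a).
  by rewrite [in RHS]gw' -!mulrnA; congr (_ *+ _); rewrite mulnA mulnC.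
have -> : w *+ v *+ (a * b) = g *+ (v * b).
  by rewrite [in RHS]gw -!mulrnA; congr (_ *+ _); rewrite mulnCA.
by rewrite uv mulrnDr addrC addKr.
Qed.

(** Divisibility by all prime powers combines over coprime factors to divisibility by every positive
    integer, so [g] would vanish by [reduced]. *)
Lemma not_prime_power_divisible : g <> 0 -> exists p n, prime p /\ ~ exists w, g = w *+ p ^ n.
Proof.
move=> g0; apply: contrapT => no; apply: g0.
have D p n : prime p -> exists w, g = w *+ p ^ n.
  by move=> pp; apply: contrapT => h; apply: no; exists p, n.
suff DN N : (0 < N)%N -> exists w, g = w *+ N by apply: reduced => N; apply: DN; exact: fact_gt0.
elim/ltn_ind: N => N IH N0.
have [N1|N1] := leqP N 1.
  by exists g; have -> : N = 1%N by apply/eqP; rewrite eqn_leq N1.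
pose p := pdiv N; have pp : prime p by exact: pdiv_prime.
rewrite -(partnC p N0); apply: divisible_mul.
- exact: coprime_partC.
- exact: part_gt0.
- by rewrite p_part; exact: D.
- apply: IH; last exact: part_gt0.
  rewrite -{2}(partnC p N0) ltn_Pmull ?part_gt0 //.
  by rewrite p_part_gt1 /p mem_primes pp N0 pdiv_dvd.
Qed.

(** * A copy of the p-adic integers *)

Section PadicMultiple.
Variables (p n : nat).
Hypothesis pp : prime p.
Hypothesis ndiv : ~ exists w, g = w *+ p ^ n.
Implicit Types xi zeta : padic_int p.

Let vp N := logn p N`!.
Let rp N := (N`!`_p^')%N.

Let fact_eq N : N`! = (p ^ vp N * rp N)%N.
Proof. by rewrite -p_part partnC // fact_gt0. Qed.

Let coprime_fact N : coprime (p ^ vp N) (rp N).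
Proof. by rewrite -p_part coprime_partC. Qed.

(** The residue modulo [N!] of the profinite idempotent that is 1 at [p] and 0 at all other primes;
    multiplication by it makes a p-adic integer profinite. *)
Let idem N := chinese (p ^ vp N) (rp N) 1 0.

Let idem1 N : idem N = 1 %[mod p ^ vp N].
Proof. by rewrite /idem chinese_modl. Qed.

Let idem0 N : idem N = 0 %[mod rp N].
Proof. by rewrite /idem chinese_modr. Qed.

(** By the index shift this is a residue modulo [p ^ (vp N).+1], one power more than [N!]
    contains. *)
Let res xi N : nat := padic_val xi (vp N).

Let pexp_gt1 k : (1 < p ^ k.+1)%N.
Proof. by rewrite -(exp1n k.+1) ltn_exp2r // prime_gt1. Qed.

Lemma padic_val_mod xi j k : (j <= k)%N ->
  (padic_val xi k : nat) = padic_val xi j %[mod p ^ j.+1].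
Proof.
elim: k => [|k IH]; first by rewrite leqn0 => /eqP ->.
rewrite leq_eqVlt => /orP[/eqP ->//|]; rewrite ltnS => jk; rewrite -(IH jk).
have := congr1 (@nat_of_ord _) (padic_valP xi k).
rewrite val_Zp_nat // => <-; rewrite modn_dvdm //.
by rewrite dvdn_exp2l.
Qed.

Lemma padic_val_add xi zeta k :
  (padic_val (xi + zeta) k : nat) = (padic_val xi k + padic_val zeta k)%N %[mod p ^ k.+1].
Proof.
rewrite -[padic_val (xi + zeta) k]/(padic_val xi k + padic_val zeta k) /=.
move: (nat_of_ord (padic_val xi k)) (nat_of_ord (padic_val zeta k)) => a b.
by rewrite Zp_cast // modn_mod.
Qed.

Let mult xi N : int := (res xi N * idem N)%N%:Z.

Let eqmod_dvdz (a b m : nat) : a = b %[mod m] -> (m%:Z %| a%:Z - b%:Z)%Z.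
Proof. by move=> e; rewrite -eqz_mod_dvd; apply/eqP; rewrite !modz_nat e. Qed.

Let eqmod_fact a b N : a = b %[mod p ^ vp N] -> a = b %[mod rp N] ->
  ((N`!)%:Z %| a%:Z - b%:Z)%Z.
Proof.
move=> h1 h2; apply: eqmod_dvdz; rewrite fact_eq; apply/eqP.
by rewrite chinese_remainder // h1 h2 !eqxx.
Qed.

Let mod_weaken a b m q : (q %| m)%N -> a = b %[mod m] -> a = b %[mod q].
Proof. by move=> qm e; rewrite -(modn_dvdm a qm) e modn_dvdm. Qed.

Let mult_coherent xi N : ((N`!)%:Z %| mult xi N.+1 - mult xi N)%Z.
Proof.
have vv : (vp N <= vp N.+1)%N by rewrite dvdn_leq_log ?fact_gt0 // fact_dvd.
apply: eqmod_fact.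
  have e1 : idem N.+1 = idem N %[mod p ^ vp N].
    by rewrite idem1; apply: (mod_weaken _ (idem1 N.+1)); rewrite dvdn_exp2l.
  have e2 : res xi N.+1 = res xi N %[mod p ^ vp N].
    by apply: mod_weaken (padic_val_mod xi vv); rewrite dvdn_exp2l.
  by rewrite -modnMml e2 modnMml -modnMmr e1 modnMmr.
have e1 : idem N.+1 = 0 %[mod rp N].
  by apply: (mod_weaken _ (idem0 N.+1)); apply: partn_dvd; rewrite ?fact_gt0 // fact_dvd.
by rewrite -modnMmr e1 -[RHS]modnMmr idem0 !mod0n !muln0.
Qed.

Let mult_add xi zeta N : ((N`!)%:Z %| mult (xi + zeta) N - (mult xi N + mult zeta N))%Z.
Proof.
rewrite /mult -PoszD -mulnDl; apply: eqmod_fact; last by rewrite -modnMmr idem0 -[RHS]modnMmr idem0 !mod0n !muln0.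
have e : res (xi + zeta) N = (res xi N + res zeta N)%N %[mod p ^ vp N].
  by apply: mod_weaken (padic_val_add xi zeta _); rewrite dvdn_exp2l.
by rewrite -modnMml e modnMml.
Qed.

(** A nonzero [xi] has finite valuation [j]. If its multiple of [g] is 0, cancelling [p ^ j] and a
    factor prime to [p] leaves [g] divisible by [p ^ (vp N - j)], which is too much for large
    [N]. *)
Lemma padic_multiple_neq0 xi : profinite_multiple (mult xi) 0 -> xi = 0.
Proof.
move=> h0; apply: contrapT => xi0; apply: ndiv.
have [k xik] : exists k, padic_val xi k <> 0.
  apply: contrapT => no; apply: xi0; apply: padic_inj => k.
  by apply: contrapT => hk; apply: no; exists k.
(* This makes [vp N] at least [k.+1 + n], so that [n] factors [p] remain after cancelling [p ^ j]
   with [j <= k]. *)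
pose N := (p ^ (k.+1 + n))%N.
have vN : (k.+1 + n <= vp N)%N.
  rewrite /vp -pfactor_dvdn ?fact_gt0 //; apply: dvdn_fact.
  by rewrite leqnn expn_gt0 prime_gt0.
have [w e0] := h0 N.
pose a := res xi N.
have ak : (padic_val xi k : nat) = a %[mod p ^ k.+1].
  apply/esym/padic_val_mod; apply: leq_trans vN.
  by rewrite addSn ltnW // ltnS leq_addr.
have a0 : ~~ (p ^ k.+1 %| a)%N.
  apply/negP => /eqP pa; apply: xik; apply: val_inj => /=.
  rewrite pa in ak; rewrite -ak modn_small //.
  by have := ltn_ord (padic_val xi k); rewrite [X in (_ < X)%N](Zp_cast (pexp_gt1 k)).
have a_gt0 : (0 < a)%N by rewrite lt0n; apply/eqP => az; rewrite az dvdn0 in a0.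
pose j := logn p a.
have jk : (j <= k)%N by rewrite leqNgt; apply/negP => kj; rewrite pfactor_dvdn // kj in a0.
have [w1 ga] : exists w1, g *+ a = w1 *+ p ^ vp N.
  have /eqmod_dvdz/dvdzP[t tE] : (a * idem N)%N = a %[mod p ^ vp N].
    by rewrite -modnMmr idem1 modnMmr muln1.
  exists (- (w *+ rp N) - g *~ t); rewrite mulrnBl mulNrn -mulrnA mulnC -fact_eq.
  have -> : - (w *+ N`!) = g *~ mult xi N by apply/eqP; rewrite eq_sym -addr_eq0 -e0.
  rewrite [X in _ - X]pmulrn -mulrzA -tE -mulrzBr opprB addrC subrK.
  by rewrite -pmulrn.
have [b pb ab] : exists2 b, coprime p b & a = (b * p ^ j)%N.
  by have [b] := pfactor_coprime pp a_gt0; exists b.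
have gb : g *+ b = w1 *+ p ^ (vp N - j).
  apply/eqP; rewrite -subr_eq0; apply/eqP; apply: (@tfH _ (p ^ j)%N).
    by rewrite expn_gt0 prime_gt0.
  have jv : (j <= vp N)%N by apply: leq_trans jk _; apply: leq_trans vN; rewrite addSn ltnW // ltnS leq_addr.
  by rewrite mulrnBl -!mulrnA -ab ga -expnD subnK // subrr.
have [||w2 ->] := divisible_coprime _ _ gb.
- by rewrite coprime_sym coprimeXl.
- by rewrite lt0n; apply/eqP => b0; rewrite ab b0 in a_gt0.
exists (w2 *+ p ^ (vp N - j - n)); rewrite -mulrnA -expnD subnK //.
by rewrite leq_subRL; lia.
Qed.

Lemma padic_embeds : has_subgroup_isomorphic_to (padic_int p) H.
Proof.
have /choice[f fP] xi : exists h, profinite_multiple (mult xi) h.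
  by apply: profinite_multiple_exists => N; exact: mult_coherent.
have fB : zmod_morphism f.
  move=> xi zeta; apply: (profinite_multiple_unique (fP _)).
  apply: profinite_multiple_eqmod (profinite_multipleB (fP xi) (fP zeta)) => N.
  by have := mult_add (xi - zeta) zeta N; rewrite subrK opprD addrA addrAC.
apply: (injective_subgroup fB) => xi zeta e.
apply/eqP; rewrite -subr_eq0; apply/eqP; apply: padic_multiple_neq0.
by have := fP (xi - zeta); rewrite fB e subrr.
Qed.

End PadicMultiple.
End PadicHom.
End Reduced.

Lemma cotorsion_free_no_multiples (H : zmodType) (g : H) : cotorsion_free H ->
  (forall c : nat -> int, exists h,
     profinite_multiple g (fun N => \sum_(l < N) c l * (l`!)%:Z) h) -> g = 0.
Proof.
move=> [tf noQ noJ] comp; apply: contrapT => g0.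
have [p [n [pp nd]]] := not_prime_power_divisible tf noQ g0.
by apply: (noJ p pp); exact: padic_embeds nd.
Qed.

(** * The group *)

Section Group.
Variables (d : Order.disp_t) (K : orderType d).
Hypothesis regK : regular_cardinal K.
Hypothesis powK : forall a : K,
  card_lt [set f : nat -> K | forall n, (f n < a)%O] [set: K].
Variables (s : K -> K) (J : (nat -> K) -> K) (iota : nat -> K).
Variable enc : (K -> germ) -> nat -> K.
Hypothesis sP : forall c, stationary [set b | s b = c].
Hypothesis J_inj : injective J.
Hypothesis iota_inj : injective iota.
Hypothesis enc_inj : forall x y, countable [set p | x p <> 0] ->
  countable [set p | y p <> 0] -> enc x = enc y -> x = y.
Hypothesis enc_bound : forall x a, (forall p, x p <> 0 -> (p < a)%O) ->
  (forall n, (iota n < a)%O) -> forall n, (enc x n < a)%O.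

Implicit Types (x y z : K -> germ) (u : nat -> nat -> K -> germ).

Definition supp x : set K := [set p | x p <> 0].

(* [m] is the class of the limit, [n] the number of the block; of [u] only the
   blocks before the n-th one are recorded. *)
Definition code_entry (m n : nat) u (g : K) (c : nat -> int)
    (t : nat + nat * nat * nat) : K :=
  match t with
  | inl 0 => iota m
  | inl 1 => iota n
  | inl 2 => g
  | inl t.+3 => iota (pickle (c t))
  | inr (i, k, t) => enc (if (i < n)%N then u i k else 0) t
  end.

Definition code m n u g c (l : nat) : K :=
  if pickle_inv l is Some t then code_entry m n u g c t else iota 0.

(** The colour reserved for the ordinals [alpha]; it differs from every code of positive class, so
    no [alpha] codes a block. *)
Definition level_code : nat -> K := fun=> iota 0.

Lemma codeE m n u g c t : code m n u g c (pickle t) = code_entry m n u g c t.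
Proof. by rewrite /code pickleK_inv. Qed.

Lemma code_level m n u g c : (0 < m)%N -> code m n u g c <> level_code.
Proof.
move=> m0 /(congr1 (@^~ (pickle (inl 0 : nat + nat * nat * nat)))).
by rewrite codeE /= => /iota_inj me; rewrite me in m0.
Qed.

Lemma code_inj m n u g c m' n' u' g' c' :
  code m n u g c = code m' n' u' g' c' -> [/\ m = m', n = n', g = g' & c = c'].
Proof.
move=> e; have E t : code_entry m n u g c t = code_entry m' n' u' g' c' t.
  by rewrite -!codeE e.
split; [exact: iota_inj (E (inl 0)) | exact: iota_inj (E (inl 1)) |
        exact: (E (inl 2)) |].
apply/funext => t; have /iota_inj := E (inl t.+3).
exact: (pcan_inj pickleK).
Qed.

Lemma code_inj_hist m n u g c u' : (forall i k, countable (supp (u i k))) ->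
  (forall i k, countable (supp (u' i k))) ->
  code m n u g c = code m n u' g c -> forall i k, (i < n)%N -> u i k = u' i k.
Proof.
move=> cu cu' e i k ni; apply: enc_inj; [exact: cu|exact: cu'|apply/funext => t].
have : code_entry m n u g c (inr (i, k, t)) = code_entry m n u' g c (inr (i, k, t)).
  by rewrite -!codeE e.
by rewrite /= ni.
Qed.

Definition unit_at (g : K) : K -> germ := fun p => if p == g then one_germ else 0.

(** The blocks in one sequence; indices that encode no pair contribute 0. *)
Definition term u (l : nat) : K -> germ :=
  if pickle_inv l is Some nk then u nk.1 nk.2 else 0.

Definition termsum u : K -> germ := fun p =>
  if pselect (exists l, term u l p <> 0) is left h then
    let l := projT1 (cid h) in term u l p *+ l`! else 0.

(* Meaningful when the terms have disjoint supports: [termsum u] is then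
   the sum over l of l! (term u l). *)
Definition limit u (g : K) (c : nat -> int) : K -> germ := fun p =>
  termsum u p + (if p == g then sum_germ c else 0).

Record admissible (m : nat) u (eta : nat -> nat -> K) (beta : nat -> K)
    (alpha g : K) (c : nat -> int) : Prop := Admissible {
  adm_supp : forall n k p, u n k p <> 0 -> (eta n k <= p)%O /\ (p < eta n k.+1)%O;
  adm_neq0 : forall n k, u n k <> 0;
  adm_eta : forall n, ladder (eta n) (beta n);
  adm_next : forall n, (beta n <= eta n.+1 0%N)%O;
  adm_beta : ladder beta alpha;
  adm_code : forall n, s (beta n) = J (code m n u g c);
  adm_level : s alpha = J level_code }.

(* The index is the class: limits of class m.+1 use elements of class m only, so
   elements of class m never accumulate at the ordinals coding class m.+1. *)
Inductive inG : nat -> (K -> germ) -> Prop :=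
| inG_unit m g : inG m (unit_at g)
| inG_sub m x y : inG m x -> inG m y -> inG m (x - y)
| inG_pure m x n : inG m (x *+ n.+1) -> inG m x
| inG_succ m x : inG m x -> inG m.+1 x
| inG_limit m u eta beta alpha g c :
    (forall n k, inG m (u n k)) -> admissible m.+1 u eta beta alpha g c ->
    inG m.+1 (limit u g c).

Lemma inG0 m : inG m 0.
Proof. by rewrite -(subrr (unit_at (iota 0))); apply: inG_sub; apply: inG_unit. Qed.

Lemma inGN m x : inG m x -> inG m (- x).
Proof. by move=> ?; rewrite -sub0r; apply: inG_sub => //; exact: inG0. Qed.

Lemma inG_leq m m' x : (m <= m')%N -> inG m x -> inG m' x.
Proof.
move=> /subnK <-; elim: (m' - m)%N => // k IH /IH ?; exact: inG_succ.
Qed.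

Lemma fun_torsion_free x n : (0 < n)%N -> x *+ n = 0 -> x = 0.
Proof.
move=> n0 e; apply/funext => p; apply: (germ_torsion_free n0).
by rewrite -mulrnfctE e.
Qed.

Lemma supp_mulrn x n : supp (x *+ n.+1) = supp x.
Proof.
apply/seteqP; split=> p; rewrite /supp /= mulrnfctE => xp h; apply: xp.
  by rewrite h mul0rn.
exact: germ_torsion_free h.
Qed.

Lemma supp_sub x y : supp (x - y) `<=` supp x `|` supp y.
Proof.
move=> p xy; apply: contrapT => /not_orP[/contrapT xp /contrapT yp].
by apply: xy; rewrite -[LHS]/(x p - y p) xp yp subrr.
Qed.

Lemma supp_unit g : supp (unit_at g) `<=` [set g].
Proof. by move=> p; rewrite /supp /unit_at /=; case: eqP. Qed.

Lemma termsum0 u p : (forall n k, u n k p = 0) -> termsum u p = 0.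
Proof.
move=> up; rewrite /termsum; case: pselect => // h; case: (cid h) => l /=.
by rewrite /term; case: pickle_inv => // -[n k] /=; rewrite up.
Qed.

Lemma supp_limit u g c :
  supp (limit u g c) `<=` (\bigcup_nk supp (u nk.1 nk.2)) `|` [set g].
Proof.
move=> p; rewrite /supp /limit /=; case: eqP => [->|pg]; first by right.
rewrite addr0 => h; left; apply: contrapT => np; apply: h; apply: termsum0 => n k.
by apply: contrapT => h; apply: np; exists (n, k).
Qed.

Lemma countable_supp m x : inG m x -> countable (supp x).
Proof.
elim=> {m x} [m g|m x y _ cx _ cy|m x n _|//|m u eta beta alpha g c _ cu _].
- by apply: sub_countable (countable1 g); apply: subset_card_le; exact: supp_unit.
- apply: (@sub_countable _ _ _ (supp x `|` supp y)).
    by apply: subset_card_le; exact: supp_sub.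
  by rewrite -bigcup2E; apply: bigcup_countable => // -[|[|]].
- by rewrite supp_mulrn.
- apply: (@sub_countable _ _ _ ((\bigcup_nk supp (u nk.1 nk.2)) `|` [set g])).
    by apply: subset_card_le; exact: supp_limit.
  rewrite -bigcup2E; apply: bigcup_countable => // -[|[|//]] _ /=.
    by apply: bigcup_countable => //; exact: cu.
  exact: countable1.
Qed.

(** * Disjoint supports and finite approximations of a limit *)

Section Admissible.
Variables (m : nat) (u : nat -> nat -> K -> germ) (eta : nat -> nat -> K).
Variables (beta : nat -> K) (alpha g : K) (c : nat -> int).
Hypothesis adm : admissible m u eta beta alpha g c.

Lemma eta_lt_beta n k : (eta n k < beta n)%O.
Proof. by have [_ h _] := adm_eta adm n. Qed.

Lemma beta_le_eta n n' k : (n < n')%N -> (beta n <= eta n' k)%O.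
Proof.
case: n' => // n' nn'; apply: le_trans (ladder_mono (adm_eta adm n'.+1) (leq0n k)).
by apply: le_trans (adm_next adm n'); apply: ladder_mono (adm_beta adm) _.
Qed.

Lemma supp_uniq n k n' k' p : u n k p <> 0 -> u n' k' p <> 0 ->
  (n = n') /\ (k = k').
Proof.
wlog : n k n' k' / ((n < n') || (n == n') && (k <= k'))%N => [hw|].
  case: (ltngtP n n') => [nn'|nn'|nn'].
  - by apply: hw; rewrite nn'.
  - by move=> h1 h2; have [|-> ->] := hw n' k' n k _ h2 h1; rewrite ?nn'.
  - subst n'; case: (leqP k k') => kk'; first by apply: hw; rewrite eqxx kk' orbT.
    move=> h1 h2; have [|_ ->//] := hw n k' n k _ h2 h1.
    by rewrite eqxx (ltnW kk') orbT.
case/orP=> [nn'|/andP[/eqP <- kk']] /(adm_supp adm)[_ h] /(adm_supp adm)[h' _].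
  suff : (eta n' k' < eta n' k')%O by rewrite ltxx.
  apply: le_lt_trans h' _; apply: lt_le_trans h _.
  by apply: le_trans (ltW (eta_lt_beta n k.+1)) (beta_le_eta k' nn').
move: kk'; rewrite leq_eqVlt => /orP[/eqP //|kk'].
have := ladder_mono (adm_eta adm n) kk'.
by rewrite leNgt (le_lt_trans h' h).
Qed.

Lemma term_uniq l l' p : term u l p <> 0 -> term u l' p <> 0 -> l = l'.
Proof.
rewrite /term.
have := pickle_invK (T := (nat * nat)%type) l.
have := pickle_invK (T := (nat * nat)%type) l'.
case: (pickle_inv l) => [[n k]|] //; case: (pickle_inv l') => [[n' k']|] //=.
by move=> <- <- /supp_uniq h/h[-> ->].
Qed.

Lemma termsumE l p : term u l p <> 0 -> termsum u p = term u l p *+ l`!.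
Proof.
move=> h; rewrite /termsum; case: pselect; last by case; exists l.
by move=> h'; case: (cid h') => l' /= /(term_uniq h) <-.
Qed.

(** At each point at most one term is nonzero. Terms of index at least [N] are divisible by [N!], as
    is the tail of [sum_germ c]. *)
Lemma limit_approx N : exists w : K -> germ, limit u g c =
  \sum_(l < N) (term u l *+ l`! + unit_at g *~ (c l * (l`!)%:Z)) + w *+ N`!.
Proof.
have [w wE] := sum_germ_approx c N.
have /choice[v vP] p : exists v, termsum u p = \sum_(l < N) term u l p *+ l`! + v *+ N`!.
  have [[l lp]|no] := pselect (exists l, term u l p <> 0); last first.
    have t0 l : term u l p = 0 by apply: contrapT => h; apply: no; exists l.
    exists 0; rewrite mul0rn addr0 big1 ?termsum0 //.
      move=> n k; have := t0 (pickle (n, k)).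
      by rewrite /term pickleK_inv.
    by move=> l _; rewrite t0 mul0rn.
  have t0 l' : l' <> l -> term u l' p = 0.
    by move=> h; apply: contrapT => h'; apply: h; apply: term_uniq h' lp.
  rewrite (termsumE lp); case: (ltnP l N) => lN.
    exists 0; rewrite mul0rn addr0 (bigD1 (Ordinal lN)) //= big1 ?addr0 //.
    by move=> i /eqP ni; rewrite t0 ?mul0rn // => il; apply: ni; apply: val_inj.
  exists (term u l p *+ (l`! %/ N`!)); rewrite big1 ?add0r.
    by rewrite -mulrnA divnK // fact_dvd.
  by move=> i _; rewrite t0 ?mul0rn // => il; move: lN; rewrite -il leqNgt ltn_ord.
exists (fun p => v p + (if p == g then w else 0)); apply/funext => p.
rewrite -[RHS]/((_ : K -> germ) p + (_ : K -> germ) p) sumfctE mulrnfctE /limit vP.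
have -> : (if p == g then sum_germ c else 0) =
    \sum_(l < N) unit_at g p *~ (c l * (l`!)%:Z) + (if p == g then w else 0) *+ N`!.
  rewrite -mulrz_sumr /unit_at; case: eqP => _; first by rewrite wE.
  by rewrite mul0rz mul0rn addr0.
rewrite mulrnDl addrACA -big_split /=; congr (_ + _); apply: eq_bigr => l _.
by rewrite -[RHS]/((_ : K -> germ) p + (_ : K -> germ) p) mulrnfctE mulrzfctE.
Qed.

End Admissible.

(** * Elements whose support does not accumulate at an ordinal from below *)

Definition vanishes_below x (b : K) :=
  exists2 e, (e < b)%O & forall p, (e <= p)%O -> (p < b)%O -> x p = 0.

Lemma vanishes_add x y b : vanishes_below x b -> vanishes_below y b ->
  vanishes_below (x + y) b.
Proof.
move=> [e eb ex] [e' eb' ey]; exists (Order.max e e'); first by rewrite gt_max eb.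
move=> p; rewrite ge_max => /andP[ep e'p] pb.
by rewrite -[LHS]/(x p + y p) ex // ey // addr0.
Qed.

Lemma vanishes_opp x b : vanishes_below x b -> vanishes_below (- x) b.
Proof.
by move=> [e eb ex]; exists e => // p ep pb; rewrite -[LHS]/(- x p) ex ?oppr0.
Qed.

Lemma vanishes_point x g b : (forall p, p <> g -> x p = 0) -> omega_limit b ->
  vanishes_below x b.
Proof.
move=> xg [l [_ lb lc]].
case: (ltP g b) => [/lc[n gl]|bg].
  exists (l n) => // p lp _; apply: xg => pg; move: lp.
  by rewrite pg leNgt gl.
exists (l 0%N) => // p _ pb; apply: xg => pg; move: bg.
by rewrite -pg leNgt pb.
Qed.

Lemma vanishes_above_level m u eta beta alpha g c b :
  admissible m u eta beta alpha g c -> omega_limit b -> (alpha < b)%O ->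
  vanishes_below (limit u g c) b.
Proof.
move=> adm ob ab.
apply: (@vanishes_add (termsum u)); last first.
  by apply: (vanishes_point (g := g)) ob => p; case: eqP.
exists alpha => // p ap pb; apply: termsum0 => n k; apply: contrapT.
move=> /(adm_supp adm)[_ h]; have [_ h1 _] := adm_beta adm.
have := le_lt_trans ap (lt_trans h (lt_trans (eta_lt_beta adm n k.+1) (h1 n))).
by rewrite ltxx.
Qed.

(** For [b < alpha], let [n0] be the first block with [b < beta n0]. Earlier blocks end before [b],
    later ones start after it, and only finitely many elements of block [n0] have support reaching
    below [b]; each of them vanishes near [b]. *)
Lemma vanishes_limit m u eta beta alpha g c b :
  admissible m u eta beta alpha g c -> omega_limit b -> b <> alpha ->
  (forall n, b <> beta n) -> (forall n k, vanishes_below (u n k) b) ->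
  vanishes_below (limit u g c) b.
Proof.
move=> adm ob ba bb ub.
case: (ltgtP b alpha) => // {ba}[ba|]; last exact: vanishes_above_level adm ob.
apply: (@vanishes_add (termsum u)); last first.
  by apply: (vanishes_point (g := g)) ob => p; case: eqP.
have exn : exists n, (b < beta n)%O by have [_ _ /(_ _ ba)] := adm_beta adm.
case: (ex_minnP exn) => n0 bn0 n0min.
have below n : (n < n0)%N -> (beta n < b)%O.
  move=> nn0; rewrite lt_neqAle; apply/andP; split; first exact/eqP/nesym/bb.
  by rewrite leNgt; apply/negP => /n0min; rewrite leqNgt nn0.
have [e0 e0b e0P] : exists2 e0, (e0 < b)%O & forall n, (n < n0)%N -> (beta n <= e0)%O.
  case: n0 below {bn0 n0min} => [|n0] below.
    by have [l [_ lb _]] := ob; exists (l 0%N).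
  exists (beta n0); first exact: below.
  by move=> n; rewrite ltnS; exact: ladder_mono (adm_beta adm).
have [k1 bk1] : exists k1, (b < eta n0 k1)%O.
  by have [_ _ /(_ _ bn0)] := adm_eta adm n0.
have [e1 e1b e1P] : exists2 e1, (e1 < b)%O & forall k, (k < k1)%N -> forall p,
    (e1 <= p)%O -> (p < b)%O -> u n0 k p = 0.
  elim: k1 {bk1} => [|k1 [e1 e1b e1P]]; first by exists e0.
  have [e eb eP] := ub n0 k1; exists (Order.max e e1); first by rewrite gt_max eb.
  move=> k; rewrite ltnS leq_eqVlt => kk1 p; rewrite ge_max => /andP[ep e1p] pb.
  by case/orP: kk1 => [/eqP ->|kk1]; [exact: eP|exact: e1P kk1 _ _ _].
exists (Order.max e0 e1); first by rewrite gt_max e0b.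
move=> p; rewrite ge_max => /andP[e0p e1p] pb; apply: termsum0 => n k.
case: (ltngtP n n0) => [nn0|nn0|->].
- apply: contrapT => /(adm_supp adm)[_ h].
  have := lt_trans h (eta_lt_beta adm n k.+1).
  by rewrite ltNge (le_trans (e0P _ nn0) e0p).
- apply: contrapT => /(adm_supp adm)[h _].
  have := le_lt_trans (le_trans (beta_le_eta adm k nn0) h) pb.
  by rewrite ltNge (ltW bn0).
- case: (ltnP k k1) => kk1; first exact: e1P kk1 _ _ _.
  apply: contrapT => /(adm_supp adm)[h _].
  have := le_lt_trans (le_trans (ladder_mono (adm_eta adm n0) kk1) h) pb.
  by rewrite ltNge (ltW bk1).
Qed.

(** An ordinal coding a class above [q] is neither an [alpha] nor a [beta n] of a limit of class at
    most [q]: the colours differ. So [vanishes_limit] carries the induction. *)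
Lemma inG_vanishes q x : inG q x -> forall m n u g c b, (q < m)%N ->
  s b = J (code m n u g c) -> omega_limit b -> vanishes_below x b.
Proof.
elim=> {q x} [q g|q x y _ IHx _ IHy|q x n _ IH|q x _ IH|q u eta beta alpha g c _ IH adm].
- move=> m n u g' c b _ _; apply: (vanishes_point (g := g)) => p pg.
  by rewrite /unit_at; case: eqP.
- move=> m n u g c b qm sb ob; apply: vanishes_add; first exact: IHx sb ob.
  by apply: vanishes_opp; exact: IHy sb ob.
- move=> m n' u g c b qm sb ob; have [e eb eP] := IH _ _ _ _ _ _ qm sb ob.
  exists e => // p ep pb; apply: (@germ_torsion_free _ n.+1) => //.
  by rewrite -mulrnfctE eP.
- by move=> m n u g c b qm; apply: IH; exact: ltnW.
- move=> m n u' g' c' b qm sb ob; apply: (vanishes_limit adm ob).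
  + move=> ba; have := adm_level adm; rewrite -ba sb => /J_inj/code_level; apply.
    exact: leq_ltn_trans qm.
  + move=> i bi; have := adm_code adm i; rewrite -bi sb => /J_inj/code_inj[mq _ _ _].
    by rewrite mq ltnn in qm.
  + by move=> i k; apply: IH sb ob; exact: ltnW.
Qed.

Lemma vanishes_all (L : seq (K -> germ)) b : omega_limit b ->
  (forall x, x \in L -> vanishes_below x b) ->
  exists2 e, (e < b)%O & forall x, x \in L -> forall p, (e <= p)%O -> (p < b)%O -> x p = 0.
Proof.
move=> [l [_ lb _]]; elim: L => [|y L IH] h; first by exists (l 0%N).
have [x xL|e eb eL] := IH; first by apply: h; rewrite inE xL orbT.
have [e' eb' ey] : vanishes_below y b by apply: h; rewrite inE eqxx.
exists (Order.max e e'); first by rewrite gt_max eb.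
move=> x; rewrite inE => /orP[/eqP ->|xL] p; rewrite ge_max => /andP[ep e'p] pb.
  exact: ey.
exact: eL xL _ _ _.
Qed.

(** * Separating functionals on pure closures of generators *)

Definition restr (A : {pred K}) x : K -> germ := fun p => if p \in A then x p else 0.

Lemma restr_is_additive A : zmod_morphism (restr A).
Proof.
by move=> x y; apply/funext => p; rewrite /restr /= -[RHS]/(_ - _); case: ifP; rewrite ?subrr.
Qed.

HB.instance Definition _ A :=
  GRing.isZmodMorphism.Build (K -> germ) (K -> germ) (restr A) (restr_is_additive A).

Definition limit_at q alpha x := exists u eta beta g c,
  [/\ forall n k, inG q (u n k), admissible q.+1 u eta beta alpha g c & x = limit u g c].

Definition generator m x := (exists g, x = unit_at g) \/
  exists q alpha, (q < m)%N /\ limit_at q alpha x.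

Lemma generatorS m x : generator m x -> generator m.+1 x.
Proof. by case=> [?|[q [a [qm h]]]]; [left|right; exists q, a; split => //; exact: ltnW]. Qed.

Lemma inG_generators m x : inG m x ->
  exists L, (forall y, y \in L -> generator m y) /\ pure_span L x.
Proof.
elim=> {m x} [m g|m x y _ [L [LG hx]] _ [L' [LG' hy]]|m x n _ [L [LG hx]]|m x _ [L [LG hx]]|
  m u eta beta alpha g c uG _ adm].
- exists [:: unit_at g]; split; last by apply: pure_span_mem; rewrite inE.
  by move=> y; rewrite inE => /eqP ->; left; exists g.
- exists (L ++ L'); split; first by move=> z; rewrite mem_cat => /orP[/LG|/LG'].
  by apply: pure_span_sub; [move: hx|move: hy]; apply: pure_span_sub_mem => z zL;
    rewrite mem_cat zL ?orbT.
- by exists L; split=> //; apply: pure_span_divn hx.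
- by exists L; split=> // y /LG; exact: generatorS.
- exists [:: limit u g c]; split; last by apply: pure_span_mem; rewrite inE.
  move=> y; rewrite inE => /eqP ->; right; exists m, alpha; split => //.
  by exists u, eta, beta, g, c.
Qed.

Lemma not_pure_span_nil x : x <> 0 -> ~ pure_span [::] x.
Proof. by move=> x0 [n n0 /= e]; apply: x0; exact: fun_torsion_free e. Qed.

(** By purity of [one_germ], the coordinate at [g] is an integer multiple of [one_germ] on the pure
    closure; the functional reads off this integer. *)
Lemma functional_unit g : exists phi, additive_on [:: unit_at g] phi /\ phi (unit_at g) <> 0.
Proof.
have /choice[iv ivP] (z : germ) : exists k, forall j, z = one_germ *~ j -> k = j.
  have [[k zk]|no] := pselect (exists k, z = one_germ *~ k); last first.
    by exists 0 => j zj; case: no; exists j.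
  exists k => j zj; apply/eqP; rewrite -subr_eq0; apply/eqP; apply: one_germ_inj.
  by rewrite mulrzBr -zk -zj subrr.
have val x : pure_span [:: unit_at g] x -> exists j, x g = one_germ *~ j.
  move=> [n n0 /= [k /eqP]]; rewrite subr_eq0 => /eqP /(congr1 (@^~ g)).
  by rewrite mulrnfctE mulrzfctE /unit_at eqxx; exact: one_germ_pure.
exists (fun x => iv (x g)); split; last first.
  by rewrite /unit_at eqxx (ivP _ 1).
move=> x y /val[j xj] /val[k yk].
rewrite (ivP _ j xj) (ivP _ k yk); apply: ivP.
by rewrite -[LHS]/(x g + y g) xj yk mulrzDr.
Qed.

Lemma functional_inG m x : (forall L, (forall y, y \in L -> generator m y) -> separated L) ->
  inG m x -> x <> 0 -> exists phi, additive_on [:: x] phi /\ phi x <> 0.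
Proof.
move=> sep /inG_generators[L [LG xL]] x0.
have [//|//||phi [a _ b]] := sep L LG [::] x; first exact: not_pure_span_nil.
exists phi; split => // y z hy hz; apply: a.
  by apply: pure_span_trans hy => w; rewrite inE => /eqP ->.
by apply: pure_span_trans hz => w; rewrite inE => /eqP ->.
Qed.

(** A common [beta n] has a single colour, which determines the class, [n], [g], [c] and the first
    [n] blocks. If this happened for arbitrarily large [n], the limits would coincide. *)
Lemma limit_beta_disjoint q u eta beta alpha g c q' u' eta' beta' alpha' g' c' :
  (forall n k, inG q (u n k)) -> admissible q.+1 u eta beta alpha g c ->
  (forall n k, inG q' (u' n k)) -> admissible q'.+1 u' eta' beta' alpha' g' c' ->
  limit u g c <> limit u' g' c' ->
  exists N, forall n n', (N <= n)%N -> beta n <> beta' n'.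
Proof.
move=> uG adm uG' adm' ne; apply: contrapT => no.
have H N : exists n, (N <= n)%N /\ code q.+1 n u g c = code q'.+1 n u' g' c'.
  apply: contrapT => nn; apply: no; exists N => n n' Nn bb; apply: nn.
  have := adm_code adm n; rewrite bb (adm_code adm' n') => /esym/J_inj e.
  by have [_ nn' _ _] := code_inj e; exists n; split => //; rewrite {2}nn'.
have [n [_ e]] := H 0%N; have [qq _ gg cc] := code_inj e.
apply: ne; rewrite -gg -cc; congr limit; apply/funext => i; apply/funext => k.
have [n1 [in1]] := H i.+1; rewrite -gg -cc -qq => e1.
by apply: code_inj_hist e1 _ _ in1 => ? ?; exact: countable_supp (_ : inG _ _).
Qed.

(** If [alpha'] is smaller, the [beta n] eventually pass it. If it is equal, the [beta n] eventually
    avoid those of [y], and the elements used by [y] have class at most [q], while [beta n] codes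
    class [q.+1]. *)
Lemma limit_vanishes q alpha u eta beta g c q' alpha' y :
  (forall n k, inG q (u n k)) -> admissible q.+1 u eta beta alpha g c ->
  limit_at q' alpha' y -> y <> limit u g c ->
  (alpha' < alpha)%O \/ alpha' = alpha /\ (q' <= q)%N ->
  exists N, forall n, (N <= n)%N -> vanishes_below y (beta n).
Proof.
move=> uG adm [u' [eta' [beta' [g' [c' [uG' adm' ->]]]]]] ne.
have ob n : omega_limit (beta n) by exists (eta n); exact: adm_eta adm n.
case=> [aa|[ea qq]].
  have [_ _ /(_ _ aa)[N aN]] := adm_beta adm.
  exists N => n Nn; apply: vanishes_above_level adm' (ob n) _.
  exact: lt_le_trans aN (ladder_mono (adm_beta adm) Nn).
have [N NP] := limit_beta_disjoint uG adm uG' adm' (nesym ne).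
exists N => n Nn; apply: (vanishes_limit adm') => //.
- move=> ba; have := adm_level adm'; rewrite -ba (adm_code adm) => /J_inj.
  exact: code_level.
- by move=> n'; exact: NP.
- by move=> i k; apply: inG_vanishes (uG' i k) _ _ _ _ _ _ _ (adm_code adm n) (ob n).
Qed.

(** Induction on the class, then on the number of generators. The one removed is a limit [w] of
    largest [alpha] and, among these, of largest class. All others vanish on some interval carrying
    one [u N k], where [w] is a multiple of [u N k]; as this has lower class, it has a functional by
    induction. *)
Theorem separated_generators m (L : seq (K -> germ)) :
  (forall y, y \in L -> generator m y) -> separated L.
Proof.
elim/ltn_ind: m L => m IHm L LG.
suff : forall n L, uniq L -> size L = n -> (forall y, y \in L -> generator m y) -> separated L.
  move=> h; apply: (@separated_eq _ (undup L)); try by move=> x; rewrite mem_undup.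
  by apply: (h _ (undup L)) => //; [exact: undup_uniq|move=> y; rewrite mem_undup; exact: LG].
move=> {LG L}; elim=> [|n IHn] L uL sL LG.
  by move/eqP: sL; rewrite size_eq0 => /eqP ->; exact: separated_nil.
suff [w [wL [A [v [N [phi [N0 resw resL aphi phiv]]]]]]] : exists w, w \in L /\
    exists (A : {pred K}) v N phi, [/\ N != 0, restr A w = v *~ N,
      forall x, x \in rem w L -> restr A x = 0, additive_on [:: v] phi & phi v <> 0].
  apply: (@separated_eq _ (w :: rem w L)).
  - by move=> x; rewrite (perm_mem (perm_to_rem wL)).
  - by move=> x; rewrite -(perm_mem (perm_to_rem wL)).
  - apply: (separated_cons_restr (res := restr A) N0 resw resL aphi phiv).
    apply: IHn; [exact: rem_uniq|by rewrite size_rem // sL|].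
    by move=> y /mem_rem; exact: LG.
pose lim (xa : (K -> germ) * (nat * K)) := (xa.2.1 < m)%N /\ limit_at xa.2.1 xa.2.2 xa.1.
(* A limit may have several presentations; [D] fixes one class and one [alpha] for it. *)
have /choice[D DP] x : exists qa, (exists q alpha, (q < m)%N /\ limit_at q alpha x) -> lim (x, qa).
  by have [[q [a h]]|no] := pselect (exists q alpha, (q < m)%N /\ limit_at q alpha x);
    [exists (q, a)|exists (0%N, k0 regK)].
pose T := [seq x <- L | `[< lim (x, D x) >] ].
(* With units only, restriction to the single point [g] isolates one of them. *)
have [T0|T0] := pselect (T = [::]).
  have LU x : x \in L -> exists g, x = unit_at g.
    move=> xL; have [//|/DP h] := LG x xL; suff : x \in T by rewrite T0.
    by rewrite mem_filter xL andbT; exact/asboolP.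
  case: L uL sL LG @T T0 LU => // w L /andP[wL _] _ _ _ _ LU.
  exists w; split; first by rewrite inE eqxx.
  have [g wg] : exists g, w = unit_at g by apply: LU; rewrite inE eqxx.
  have [phi [aphi phig]] := functional_unit g.
  exists (fun p => p == g), (unit_at g), 1, phi; split => //.
    rewrite mulr1z wg; apply/funext => p; rewrite /restr /unit_at unfold_in.
    by case: eqP.
  rewrite /= eqxx => x xL.
  have [g' xg'] : exists g, x = unit_at g by apply: LU; rewrite inE xL orbT.
  apply/funext => p; rewrite /restr xg' /unit_at unfold_in; case: eqP => // ->.
  by case: eqP => // gg'; move: wL; rewrite wg gg' -xg' xL.
pose R x y := ((D x).2 < (D y).2)%O \/ (D x).2 = (D y).2 /\ ((D x).1 <= (D y).1)%N.
have [||w wT wmax] := @seq_has_max _ R T _ _ T0.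
- move=> x y; case: (ltgtP (D x).2 (D y).2) => h; [by left; left|by right; left|].
  by have [h'|h'] := orP (leq_total (D x).1 (D y).1); [left|right]; right.
- move=> y x z [xy|[xy xy']] [yz|[yz yz']].
  + by left; exact: lt_trans yz.
  + by left; rewrite -yz.
  + by left; rewrite xy.
  + by right; rewrite xy yz; split => //; exact: leq_trans yz'.
have wL : w \in L by move: wT; rewrite mem_filter => /andP[].
have /asboolP[qm] : `[< lim (w, D w) >] by move: wT; rewrite mem_filter => /andP[].
move=> /= [u [eta [beta [g [c [uG adm wE]]]]]].
exists w; split => //.
have van y : y \in rem w L -> exists N, forall n, (N <= n)%N -> vanishes_below y (beta n).
  rewrite mem_rem_uniq // inE => /andP[/eqP yw yL].
  have [[g' ->]|/DP hy] := LG y yL.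
    exists 0%N => i _; apply: (vanishes_point (g := g')).
      by move=> p pg; rewrite /unit_at; case: eqP.
    by exists (eta i); exact: adm_eta adm i.
  have yT : y \in T by rewrite mem_filter yL andbT; exact/asboolP.
  apply: (limit_vanishes uG adm (proj2 hy)) (wmax y yT).
  by rewrite /= -wE.
have [N NP] : exists N, forall y, y \in rem w L -> vanishes_below y (beta N).
  suff [N NP] : exists N, forall y, y \in rem w L -> forall n, (N <= n)%N ->
      vanishes_below y (beta n) by exists N => y yL; exact: NP yL _ _.
  elim: (rem w L) van => [|y L' IH] van; first by exists 0%N.
  have [|N NP] := IH; first by move=> x xL; apply: van; rewrite inE xL orbT.
  have [|N' NP'] := van y; first by rewrite inE eqxx.
  exists (maxn N N') => x; rewrite inE => /orP[/eqP ->|xL] i; rewrite geq_max => /andP[Ni N'i].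
    exact: NP'.
  exact: NP xL _ _.
have oN : omega_limit (beta N) by exists (eta N); exact: adm_eta adm N.
(* Including [unit_at g] keeps the interval away from [g], where [w] has the extra summand
   [sum_germ c]. *)
have [|e eb eP] := @vanishes_all (unit_at g :: rem w L) _ oN.
  move=> x; rewrite inE => /orP[/eqP ->|]; last exact: NP.
  by apply: (vanishes_point (g := g)) oN => p pg; rewrite /unit_at; case: eqP.
have [_ eb' /(_ _ eb)[k ek]] := adm_eta adm N.
pose A : {pred K} := fun p => (eta N k <= p)%O && (p < eta N k.+1)%O.
have AP p : p \in A -> (e <= p)%O /\ (p < beta N)%O.
  move=> /andP[h1 h2]; split; first exact: le_trans (ltW ek) h1.
  exact: lt_trans h2 (eb' _).
have [phi [aphi phiv]] := functional_inG (IHm _ qm) (uG N k) (@adm_neq0 _ _ _ _ _ _ _ adm N k).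
(* The multiplier is the factorial with which [u N k] enters [termsum u]. *)
exists A, (u N k), (((pickle (N, k))`!)%:Z), phi; split => //.
- by rewrite eqz_nat -lt0n fact_gt0.
- rewrite -pmulrn; apply/funext => p; rewrite mulrnfctE /restr; case: ifP => pA.
    have [ep pb] := AP p pA.
    have := eP (unit_at g) (mem_head _ _) p ep pb.
    rewrite /unit_at wE /limit; case: eqP => _.
      by rewrite -[one_germ]mulr1z => /one_germ_inj.
    move=> _; rewrite addr0.
    have tE : term u (pickle (N, k)) = u N k by rewrite /term pickleK_inv.
    have [u0|u0] := pselect (u N k p = 0); last by rewrite (termsumE adm (l := pickle (N, k))) tE.
    rewrite u0 mul0rn; apply: termsum0 => i j; apply: contrapT => uij.
    have [h1 h2] := adm_supp adm uij.
    move: pA => /andP[h3 h4]; apply: uij.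
    case: (ltngtP i N) => iN.
    + suff : (p < p)%O by rewrite ltxx.
      apply: lt_le_trans h2 _; apply: le_trans h3.
      by apply: le_trans (ltW (eta_lt_beta adm _ _)) (beta_le_eta adm _ iN).
    + suff : (p < p)%O by rewrite ltxx.
      apply: lt_le_trans h4 _; apply: le_trans h1.
      by apply: le_trans (ltW (eta_lt_beta adm _ _)) (beta_le_eta adm _ iN).
    + rewrite iN in h1 h2 *; case: (ltngtP j k) => jk.
      * suff : (p < p)%O by rewrite ltxx.
        by apply: lt_le_trans h2 _; apply: le_trans h3; exact: ladder_mono (adm_eta adm N) jk.
      * suff : (p < p)%O by rewrite ltxx.
        by apply: lt_le_trans h4 _; apply: le_trans h1; exact: ladder_mono (adm_eta adm N) jk.
      * by rewrite jk.
  have [//|pu] := pselect (u N k p = 0); first by move=> ->; rewrite mul0rn.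
  by move: pA; rewrite /A unfold_in; have [-> ->] := adm_supp adm pu.
- move=> x xL; apply/funext => p; rewrite /restr; case: ifP => // /AP[ep pb].
  by apply: eP ep pb; rewrite inE xL orbT.
Qed.

(** * The group and its aleph_1-freeness *)

Definition in_group : {pred K -> germ} := fun x => `[< exists m, inG m x >].

Lemma in_groupP x : reflect (exists m, inG m x) (x \in in_group).
Proof. exact: asboolP. Qed.

Lemma in_group_closed : zmod_closed in_group.
Proof.
split; first by apply/in_groupP; exists 0%N; exact: inG0.
move=> x y /in_groupP[m xm] /in_groupP[n yn]; apply/in_groupP; exists (maxn m n).
by apply: inG_sub; [apply: inG_leq xm; exact: leq_maxl|apply: inG_leq yn; exact: leq_maxr].
Qed.

HB.instance Definition _ :=
  GRing.isZmodClosed.Build (K -> germ) in_group in_group_closed.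

Record group := Group { gval : K -> germ; gvalP : gval \in in_group }.
HB.instance Definition _ := [isSub for gval].
HB.instance Definition _ := [Choice of group by <:].
HB.instance Definition _ := [SubChoice_isSubZmodule of group by <:].

Lemma gval_inG (x : group) : exists m, inG m (val x).
Proof. exact/in_groupP/gvalP. Qed.

Lemma zspan_val (S : seq group) (x : group) : zspan S x <-> zspan (map val S) (val x).
Proof.
elim: S x => [|g S IH] x /=.
  by split=> [->|e]; rewrite ?raddf0 //; apply: val_inj; rewrite [LHS]e raddf0.
split=> -[k h]; exists k.
  by move/IH: h; rewrite raddfB raddfMz.
by apply/IH; rewrite raddfB raddfMz.
Qed.

Lemma pure_span_val (S : seq group) (x : group) : pure_span S x <-> pure_span (map val S) (val x).
Proof. by split=> -[n n0 h]; exists n => //; move: h; rewrite -raddfMn => /zspan_val. Qed.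

Lemma group_torsion_free : torsion_free group.
Proof.
move=> x n n0 e; apply: val_inj; apply: (fun_torsion_free n0).
by rewrite -[LHS](raddfMn val) e.
Qed.

Lemma group_aleph1_free : aleph1_free group.
Proof.
move=> U; apply: countable_free; first exact: group_torsion_free.
move=> S z nz.
have [L [m [LG LS]]] : exists (L : seq (K -> germ)) m,
    (forall y, y \in L -> generator m y) /\ forall x : group, x \in z :: S -> pure_span L (val x).
  elim: (z :: S) => [|x S' [L [m [LG LS]]]]; first by exists [::], 0%N.
  have [q xq] := gval_inG x.
  have [L' [LG' xL']] := inG_generators (inG_leq (leq_maxr m q) xq).
  exists (L ++ L'), (maxn m q); split.
    move=> y; rewrite mem_cat => /orP[/LG|/LG' //].
    case=> [?|[q' [a [q'm h]]]]; [by left|right; exists q', a; split => //].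
    exact: leq_trans q'm (leq_maxl _ _).
  move=> y; rewrite inE => /orP[/eqP ->|/LS].
    by apply: pure_span_sub_mem xL' => w wL; rewrite mem_cat wL orbT.
  by apply: pure_span_sub_mem => w wL; rewrite mem_cat wL.
have [|||phi [a b c]] := separated_generators LG (S := map val S) (z := val z).
- by move=> _ /mapP[x xS ->]; apply: LS; rewrite inE xS orbT.
- by apply: LS; rewrite inE eqxx.
- by move=> /pure_span_val.
exists (phi \o val); split => [x y hx hy|x xS|//]; last by apply: b; exact: map_f.
have h (w : group) : pure_span (z :: S) w -> pure_span L (val w).
  move=> /pure_span_val; apply: pure_span_trans => _ /mapP[t tS ->]; exact: LS.
by rewrite -[LHS]/(phi (val (x + y))) raddfD; apply: a; exact: h.
Qed.

(** * Cardinality of the group, and subgroups of full size *)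

Lemma unit_in_group g : unit_at g \in in_group.
Proof. by apply/in_groupP; exists 0%N; exact: inG_unit. Qed.

Lemma group_card : [set: group] #= [set: K].
Proof.
apply/card_eqPle; split.
  apply: (@card_le_inj _ _ _ _ (fun x : group => J (enc (val x)))) => // x y _ _ /J_inj e.
  have [[m xm] [n yn]] := (gval_inG x, gval_inG y).
  by apply: val_inj; apply: enc_inj e; [exact: countable_supp xm|exact: countable_supp yn].
apply: (@card_le_inj _ _ _ _ (fun g => Group (unit_in_group g))) => // g g' _ _.
move=> /(congr1 val)/(congr1 (@^~ g)); rewrite /= /unit_at eqxx.
by case: eqP => // _; rewrite -[one_germ]mulr1z => /one_germ_inj.
Qed.

(** Otherwise restriction below [a] is injective on [U], and the codes of the restrictions, being
    sequences below a fixed bound, make [U] small. *)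
Lemma large_subgroup_tail (U : zmodClosed group) : [set` U] #= [set: K] ->
  forall a, exists v, [/\ v \in U, v <> 0 & forall p, val v p <> 0 -> (a <= p)%O].
Proof.
move=> cU a; apply: contrapT => no.
suff sU : small K [set` U] by apply: (small_lt powK sU); case/card_eqPle: cU.
have [i0 i0P] := nat_bounded regK powK iota.
exists (Order.max a i0).
pose A : {pred K} := fun p => (p < a)%O.
apply: (@card_le_inj _ _ _ _ (fun x : group => enc (restr A (val x)))).
  move=> x _ n; apply: enc_bound; last by move=> j; rewrite lt_max i0P orbT.
  by move=> p; rewrite /restr unfold_in lt_max; case: (ltP p a).
move=> x y /= xU yU /enc_inj e.
have cs (z : group) : countable [set p | restr A (val z) p <> 0].
  have [m /countable_supp] := gval_inG z; apply: sub_countable; apply: subset_card_le.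
  by move=> p /=; rewrite /restr; case: ifP.
apply/eqP; rewrite -subr_eq0; apply/eqP; apply: contrapT => xy; apply: no.
exists (x - y); split => //; first by rewrite rpredB.
move=> p; rewrite leNgt raddfB => h; apply/negP => pa; apply: h.
have := congr1 (@^~ p) (e (cs x) (cs y)); rewrite /restr unfold_in pa => h.
by apply/eqP; rewrite subr_eq0; apply/eqP.
Qed.

(** If each of the countably many classes failed at some [a m], an element of [U] beyond all [a m]
    would have no class. *)
Lemma large_subgroup_class (U : zmodClosed group) : [set` U] #= [set: K] ->
  exists m, forall a, exists v, [/\ v \in U, v <> 0, inG m (val v) &
    forall p, val v p <> 0 -> (a <= p)%O].
Proof.
move=> cU; apply: contrapT => no.
have /choice[a aP] m : exists a, ~ exists v, [/\ v \in U, v <> 0, inG m (val v) &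
    forall p, val v p <> 0 -> (a <= p)%O].
  by apply: contrapT => h; apply: no; exists m => a; apply: contrapT => h';
    apply: h; exists a.
have [a0 a0P] := nat_bounded regK powK a.
have [v [vU v0 vs]] := large_subgroup_tail cU a0.
have [m vm] := gval_inG v; apply: (aP m); exists v; split => // p /vs.
exact: le_trans (ltW (a0P m)).
Qed.

Lemma code_ext m n u u' g c : (forall i k, (i < n)%N -> u i k = u' i k) ->
  code m n u g c = code m n u' g c.
Proof.
move=> h; apply/funext => l; rewrite /code; case: pickle_inv => // -[t|[[i k] t]] //=.
by case: ifP => // /h ->.
Qed.

(** * Building admissible families from elements supported far out *)

Section Catch.
Variables (m : nat) (A : set (K -> germ)) (g : K) (c : nat -> int).
Hypothesis countA : forall x, A x -> countable (supp x).
Hypothesis tailA : forall a, exists x,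
  [/\ A x, x <> 0 & forall p, x p <> 0 -> (a <= p)%O].

(** An ordinal [b] of colour [del], closed under a bound for the supports of the chosen elements,
    leaves room to choose them successively below [b]. *)
Lemma block_exists (del x0 : K) : exists (b : K) (e : nat -> K) (u : nat -> K -> germ),
  [/\ s b = del, (x0 < b)%O, e 0%N = x0, ladder e b &
   forall k, [/\ A (u k), u k <> 0 & forall p, u k p <> 0 -> (e k <= p)%O /\ (p < e k.+1)%O]].
Proof.
have /choice[v vP] := tailA.
have /choice[nx nxP] a : exists b, (a < b)%O /\ forall p, v a p <> 0 -> (p < b)%O.
  have [va _ _] := vP a; have [b1 b1P] := small_bounded regK powK (small_countable regK (countA va)).
  have [b2 ab2] := no_max regK a; exists (Order.max b1 b2); split; first by rewrite lt_max ab2 orbT.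
  by move=> p /b1P h; rewrite lt_max h.
have [b [sb [l [lS lb lc]] cb xb]] := stationary_above nx x0 (sP del).
(* Jumping past [l k] at each stage makes [e] cofinal in [b]. *)
pose e := fix e k := if k is k'.+1 then nx (Order.max (e k') (l k')) else x0.
have eb k : (e k < b)%O.
  by elim: k => //= k IH; apply: cb; rewrite gt_max IH lb.
have eS k : (e k < e k.+1)%O.
  have [h _] := nxP (Order.max (e k) (l k)); apply: le_lt_trans h.
  by rewrite le_max lexx.
exists b, e, (fun k => v (Order.max (e k) (l k))); split => //.
- split => // y /lc[k yk]; exists k.+1; apply: lt_trans yk _.
  have [h _] := nxP (Order.max (e k) (l k)); apply: le_lt_trans h.
  by rewrite le_max lexx orbT.
- move=> k; have [va v0 vs] := vP (Order.max (e k) (l k)); split => // p hp; split.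
    by apply: le_trans (vs p hp); rewrite le_max lexx.
  by have [_] := nxP (Order.max (e k) (l k)); apply.
Qed.

(** The blocks are built along a ladder [l], each coloured by its history. Since the sequences below
    a given ordinal form a small set, one function bounds all ordinals [beta n] so obtained; [alpha]
    is a closure point of it with the level colour, and [l] its ladder. *)
Lemma admissible_exists : exists u eta beta alpha,
  (forall n k, A (u n k)) /\ admissible m u eta beta alpha g c.
Proof.
have /choice[blk blkP] (dx : K * K) : exists t : K * (nat -> K) * (nat -> K -> germ),
    [/\ s t.1.1 = dx.1, (dx.2 < t.1.1)%O, t.1.2 0%N = dx.2, ladder t.1.2 t.1.1 &
     forall k, [/\ A (t.2 k), t.2 k <> 0 & forall p, t.2 k p <> 0 ->
       (t.1.2 k <= p)%O /\ (p < t.1.2 k.+1)%O]].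
  by have [b [e [u h]]] := block_exists dx.1 dx.2; exists (b, e, u).
pose cur n (st : (nat -> nat -> K -> germ) * K) := blk (J (code m n st.1 g c), st.2).
(* The state consists of the blocks built so far and the point where the next block starts. *)
pose run (l : nat -> K) := fix run n :=
  if n is n'.+1 then
    let st := run n' in
    (fun i => if i == n' then (cur n' st).2 else st.1 i, Order.max (cur n' st).1.1 (l n'.+1))
  else (fun _ _ => 0 : K -> germ, l 0%N).
have run_ext l l' n : (forall i, (i <= n)%N -> l i = l' i) -> run l n = run l' n.
  elim: n => [|n IH] h /=; first by rewrite h.
  by rewrite IH ?h // => i ni; apply: h; exact: leqW.
have /choice[Phi PhiP] a : exists b, forall l, (forall i, (l i < a)%O) ->
    forall n, ((cur n (run l n)).1.1 < b)%O.
  have /choice[f fP] l := nat_bounded regK powK (fun n => (cur n (run l n)).1.1).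
  have [|b bP] := fun_bounded regK powK f (A := [set l | forall i, (l i < a)%O]).
    by exists a.
  by exists b => l la n; apply: lt_trans (fP l n) (bP l la).
have [alpha [sa [l lad] ca]] := sP (J level_code) Phi.
have [lS la lc] := lad.
pose st n := run l n; pose beta n := (cur n (st n)).1.1.
have lst n : (l n <= (st n).2)%O by case: n => //= n; rewrite le_max lexx orbT.
have stb n : ((st n).2 < beta n)%O by have [] := blkP (J (code m n (st n).1 g c), (st n).2).
have bst n : (beta n <= (st n.+1).2)%O by rewrite /= le_max lexx.
have hist n i : (i < n)%N -> (st n).1 i = (cur i (st i)).2.
  elim: n => // n IH; rewrite ltnS leq_eqVlt /= => /orP[/eqP ->|ni]; first by rewrite eqxx.
  by rewrite ltn_eqF // IH.
exists (fun n => (cur n (st n)).2), (fun n => (cur n (st n)).1.2), beta, alpha.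
split; first by move=> n k; have [_ _ _ _ /(_ k)[]] := blkP (J (code m n (st n).1 g c), (st n).2).
split.
- by move=> n k; have [_ _ _ _ /(_ k)[]] := blkP (J (code m n (st n).1 g c), (st n).2).
- by move=> n k; have [_ _ _ _ /(_ k)[]] := blkP (J (code m n (st n).1 g c), (st n).2).
- by move=> n; have [] := blkP (J (code m n (st n).1 g c), (st n).2).
- move=> n; have [_ _ e0 _ _] := blkP (J (code m n.+1 (st n.+1).1 g c), (st n.+1).2).
  by rewrite /cur e0; exact: bst.
- split.
  + by move=> n; apply: le_lt_trans (bst n) (stb n.+1).
  (* Only [l 0] to [l n] influence [beta n]. The truncated ladder stays below [l n.+1 < alpha], so
     closure of [alpha] under [Phi] applies. *)
  + move=> n; pose l' i := l (minn i n).
    have e : run l n = run l' n.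
      by apply: run_ext => i ni; rewrite /l' (minn_idPl ni).
    apply: lt_trans (ca _ (la n.+1)); rewrite /beta /st e; apply: PhiP => i.
    by apply: le_lt_trans (lS n); apply: ladder_mono lad _; exact: geq_minr.
  + by move=> x /lc[n xl]; exists n; apply: lt_le_trans xl _; apply: ltW; exact: le_lt_trans (stb n).
- move=> n; have [-> _ _ _ _] := blkP (J (code m n (st n).1 g c), (st n).2).
  by congr J; apply: code_ext => i k ni; rewrite hist.
- exact: sa.
Qed.

End Catch.

(** * Limits modulo a subgroup of full size *)

Section Quotient.
Variable U : zmodClosed group.
Local Notation quo := {ideal_quot U}.
Local Notation proj := (\pi_quo)%qT.

(** Modulo [U] the terms in [limit_approx] vanish; the remainder [w] lies in the group because the
    group is closed under pure roots. *)
Lemma limit_multiple m u eta beta alpha g c (X E : group) :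
  admissible m u eta beta alpha g c -> val X = limit u g c -> val E = unit_at g ->
  (forall n k, exists2 v, v \in U & val v = u n k) ->
  profinite_multiple (proj E) (fun N => \sum_(l < N) c l * (l`!)%:Z) (proj X).
Proof.
move=> adm XE EE uU N.
have /choice[T TP] l : exists t : group, t \in U /\ val t = term u l.
  rewrite /term; case: pickle_inv => [[n k]|]; last by exists 0; rewrite rpred0 raddf0.
  by have [v vU ve] := uU n k; exists v.
have [w wE] := limit_approx adm N.
pose Y := X - \sum_(l < N) (T l *+ l`! + E *~ (c l * (l`!)%:Z)).
have YE : val Y = w *+ N`!.
  transitivity (val X - val (\sum_(l < N) (T l *+ l`! + E *~ (c l * (l`!)%:Z)))).
    exact: raddfB.
  have -> : val (\sum_(l < N) (T l *+ l`! + E *~ (c l * (l`!)%:Z))) =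
      \sum_(l < N) (term u l *+ l`! + unit_at g *~ (c l * (l`!)%:Z)).
    rewrite raddf_sum; apply: eq_bigr => l _.
    by rewrite raddfD raddfMn raddfMz /= -(TP l).2 -EE.
  by rewrite XE wE addrC addKr.
have wG : w \in in_group.
  have [q Yq] := gval_inG Y; apply/in_groupP; exists q.
  by apply: (@inG_pure _ _ (N`!).-1); rewrite prednK ?fact_gt0 // -YE.
exists (proj (Group wG)).
have -> : X = \sum_(l < N) (T l *+ l`! + E *~ (c l * (l`!)%:Z)) + Group wG *+ N`!.
  have -> : Group wG *+ N`! = Y by apply: val_inj; rewrite YE raddfMn.
  by rewrite /Y addrC subrK.
rewrite raddfD raddfMn /= raddf_sum; congr (_ + _).
rewrite mulrz_sumr; apply: eq_bigr => l _; rewrite raddfD raddfMn raddfMz /=.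
have /eqP -> : proj (T l) == 0 by rewrite pi_quot0 (TP l).1.
by rewrite mul0rn add0r.
Qed.

Lemma large_subgroup_full : [set` U] #= [set: K] -> cotorsion_free quo ->
  forall x : group, x \in U.
Proof.
move=> cU cf; have [m mP] := large_subgroup_class cU.
(* For every [c], a family caught inside [U] provides the multiple of the class of the unit, so this
   class vanishes by cotorsion-freeness. *)
have units g : Group (unit_in_group g) \in U.
  rewrite -pi_quot0; apply/eqP; apply: (cotorsion_free_no_multiples cf) => c.
  pose A := [set x | inG m x /\ exists2 v, v \in U & val v = x].
  have [x [xm _]||u [eta [beta [alpha [uA adm]]]]] := @admissible_exists m.+1 A g c.
  - exact: countable_supp xm.
  - move=> a; have [v [vU v0 vm va]] := mP a; exists (val v); split => //.
      by split => //; exists v.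
    by move=> e; apply: v0; apply: val_inj; rewrite e raddf0.
  have yG : limit u g c \in in_group.
    apply/in_groupP; exists m.+1; apply: inG_limit adm => n k.
    by have [] := uA n k.
  exists (proj (Group yG)); apply: (limit_multiple adm) => // n k.
  by have [] := uA n k.
have [tf noQ _] := cf.
have pureU (x : group) n : (0 < n)%N -> x *+ n \in U -> x \in U.
  move=> n0; rewrite -!pi_quot0 => /eqP; rewrite raddfMn => /(tf _ _ n0) ->.
  exact: eqxx.
suff main q y : inG q y -> forall x : group, val x = y -> x \in U.
  by move=> x; have [q xq] := gval_inG x; exact: main xq x erefl.
elim=> {q y} [q g|q y z yq IHy zq IHz|q y n yq IH|//|q u eta beta alpha g c uq IH adm] x xE.
- by have -> : x = Group (unit_in_group g) by apply: val_inj; exact: xE.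
- have yG : y \in in_group by apply/in_groupP; exists q.
  have zG : z \in in_group by apply/in_groupP; exists q.
  have -> : x = Group yG - Group zG by apply: val_inj; rewrite xE raddfB.
  by apply: rpredB; [exact: IHy|exact: IHz].
- by apply: (pureU x n.+1) => //; apply: IH; rewrite raddfMn /= xE.
(* With the unit in [U], the class of the limit is divisible by all factorials, hence zero in the
   reduced quotient. *)
- rewrite -pi_quot0; apply/eqP; apply: (reduced tf noQ) => N.
  have [|w ->] := limit_multiple adm xE (erefl : val (Group (unit_in_group g)) = _) _ N.
    move=> n k; have uG : u n k \in in_group by apply/in_groupP; exists q.
    by exists (Group uG) => //; exact: IH.
  have /eqP -> : proj (Group (unit_in_group g)) == 0 by rewrite pi_quot0.
  by exists w; rewrite mul0rz add0r.
Qed.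

End Quotient.
End Group.

Theorem theorem2p8 (d : Order.disp_t) (K : orderType d)
    (regK : regular_cardinal K)
    (powK : forall a : K,
       card_lt [set f : nat -> K | forall n, (f n < a)%O] [set: K]) :
  exists G : zmodType,
    [/\ aleph1_free G,
        [set: G] #= [set: K] &
        forall U : zmodClosed G, [set` U] #= [set: K] ->
          [set` U] = [set: G] \/ ~ cotorsion_free {ideal_quot U}].
Proof.
have [s sP] := stationary_partition regK powK.
have [J J_inj] := seq_inj regK powK.
have [iota iota_inj] := nat_inj regK.
have [enc [enc_inj enc_bound]] := countable_support_code iota_inj.
exists (group s J iota enc); split.
- exact: group_aleph1_free.
- exact: group_card.
- move=> U cU; have [cf|ncf] := pselect (cotorsion_free {ideal_quot U}); last by right.
  left; apply/seteqP; split=> // x _ /=.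
  exact: (large_subgroup_full regK powK sP enc_inj enc_bound cU cf).
Qed.
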